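(* Let $0<\delta_1<\delta_2$ be known real numbers that are not even integers, and let $c_1,c_2\in\mathbb R$ be such that $c_1|\boldsymbol t|^{\delta_1}+c_2|\boldsymbol t|^{\delta_2}$ is conditionally positive definite of order $\lfloor\delta_2/2\rfloor$ on $\mathbb R^d$. Suppose $Y$ is a mean zero Gaussian random field on $\mathbb R^d$ with generalized autocovariance function $c_1|\boldsymbol t|^{\delta_1}+c_2|\boldsymbol t|^{\delta_2}$, observed on $\Omega\cap\{\mathbb Z^d/n\}$, where $\Omega$ is a (nonempty) bounded open subset of $\mathbb R^d$. Let $\boldsymbol h\in\mathbb R^d$ be a fixed nonzero vector. If $0<2(\delta_2-\delta_1)<d$, then there exist integers $q>p>0$ such that the estimators $$\hat c_1=\frac{Q_n^p}{C_{p,\delta_1}},\qquad \hat c_2=n^{\delta_2-\delta_1}\,\frac{Q_n^p-\frac{C_{p,\delta_1}}{C_{q,\delta_1}}Q_n^q}{C_{p,\delta_2}-\frac{C_{p,\delta_1}}{C_{q,\delta_1}}C_{q,\delta_2}}$$ are well defined (all denominators nonzero) and converge with probability one to $c_1$ and $c_2$, respectively, as $n\to\infty$.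
   Context: $|\cdot|$ is the Euclidean norm. With $k=\lfloor\delta_2/2\rfloor$, that the Gaussian field $Y$ has generalized autocovariance function $G$ (conditionally positive definite of order $k$) means that $Y$ is an intrinsic random function of order $k$: for all finite linear combinations $\sum_i a_iY(\boldsymbol s_i)$ and $\sum_j b_jY(\boldsymbol t_j)$ whose coefficients annihilate all polynomials on $\mathbb R^d$ of degree at most $k$ (i.e. $\sum_i a_iP(\boldsymbol s_i)=0=\sum_jb_jP(\boldsymbol t_j)$), their covariance is $\sum_{i,j}a_ib_jG(\boldsymbol s_i-\boldsymbol t_j)$. Increments: $\Delta_{\boldsymbol h}Y(\boldsymbol t)=Y(\boldsymbol t+\boldsymbol h)-Y(\boldsymbol t)$, $\Delta^m_{\boldsymbol h}Y(\boldsymbol t)=\Delta_{\boldsymbol h}\Delta_{\boldsymbol h}^{m-1}Y(\boldsymbol t)$. With $\Omega_n=\Omega\cap\{\mathbb Z^d/n\}$ and $\#\Omega_n$ its cardinality, $$Q_n^p=\frac1{\#\Omega_n}\sum_{\boldsymbol j\in\Omega_n}n^{\delta_1}\bigl(\Delta^p_{\boldsymbol h/n}Y(\boldsymbol j)\bigr)^2,\qquad C_{p,\delta}=|\boldsymbol h|^\delta\sum_{i,j=0}^p(-1)^{i+j}\binom pi\binom pj|i-j|^\delta .$$ The increments $\Delta^p_{\boldsymbol h/n}Y(\boldsymbol j)$, $\boldsymbol j\in\Omega_n$, are taken to be available (i.e. $Y$ is observed on a region slightly larger than $\Omega_n$). *)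

(* Defs.v *)
From mathcomp Require Import all_boot all_order all_algebra finmap.
From mathcomp Require Import all_classical all_reals all_analysis.
(* Imported without its notations, which clash with MathComp-Analysis. *)
From mathcomp Require mpoly.
Import (canonicals, coercions) mpoly.
Set Implicit Arguments.
Unset Strict Implicit.
Unset Printing Implicit Defensive.
Import Order.TTheory GRing.Theory Num.Theory.
Import numFieldNormedType.Exports.
Local Open Scope classical_set_scope.
Local Open Scope ring_scope.

(* The library norm `|x| on 'rV[R]_d is the sup norm, which induces the same
   open and bounded sets. *)
Definition enorm (R : realType) (d : nat) (x : 'rV[R]_d) : R :=
  Num.sqrt (\sum_(l < d) x ord0 l ^+ 2).

(* [msize P] is 1 + the total degree of P, and 0 for P = 0. *)
Definition annihilates (R : realType) (d k m : nat)
    (a : 'I_m -> R) (s : 'I_m -> 'rV[R]_d) : Prop :=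
  forall P : mpoly.mpoly d R, (mpoly.msize P <= k.+1)%N ->
    \sum_(i < m) a i * mpoly.meval (fun l => s i ord0 l) P = 0.

Definition cond_posdef (R : realType) (d k : nat) (G : 'rV[R]_d -> R) : Prop :=
  forall (m : nat) (a : 'I_m -> R) (s : 'I_m -> 'rV[R]_d),
    annihilates k a s ->
    0 <= \sum_(i < m) \sum_(j < m) a i * a j * G (s i - s j).

Definition lincomb (R : realType) (d : nat) (disp : measure_display)
    (T : measurableType disp) (Y : 'rV[R]_d -> T -> R)
    (m : nat) (a : 'I_m -> R) (s : 'I_m -> 'rV[R]_d) : T -> R :=
  fun w => \sum_(i < m) a i * Y (s i) w.

(* The degenerate law is treated apart because [normal_prob mu 0] is not the
   Dirac mass at mu but the uniform law on [0, 1]. *)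
Definition gaussian (R : realType) (disp : measure_display)
    (T : measurableType disp) (P : probability T R) (X : T -> R) : Prop :=
  exists mu sigma : R, 0 <= sigma /\
    forall A : set R, measurable A ->
      P (X @^-1` A) = if sigma == 0 then \d_mu A else normal_prob mu sigma A.

Definition gaussian_field (R : realType) (d : nat) (disp : measure_display)
    (T : measurableType disp) (P : probability T R)
    (Y : 'rV[R]_d -> {RV P >-> R}) : Prop :=
  forall (m : nat) (a : 'I_m -> R) (s : 'I_m -> 'rV[R]_d),
    gaussian P (lincomb Y a s).

Definition mean_zero (R : realType) (d : nat) (disp : measure_display)
    (T : measurableType disp) (P : probability T R)
    (Y : 'rV[R]_d -> {RV P >-> R}) : Prop :=
  forall t : 'rV[R]_d, ('E_P[Y t] = 0)%E.

Definition generalized_autocov (R : realType) (d : nat)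
    (disp : measure_display) (T : measurableType disp) (P : probability T R)
    (k : nat) (Y : 'rV[R]_d -> {RV P >-> R}) (G : 'rV[R]_d -> R) : Prop :=
  forall (m1 m2 : nat) (a : 'I_m1 -> R) (s : 'I_m1 -> 'rV[R]_d)
    (b : 'I_m2 -> R) (t : 'I_m2 -> 'rV[R]_d),
    annihilates k a s -> annihilates k b t ->
    covariance P (lincomb Y a s) (lincomb Y b t) =
      (\sum_(i < m1) \sum_(j < m2) a i * b j * G (s i - t j))%:E.

Definition increment (R : realType) (d : nat) (h : 'rV[R]_d)
    (f : 'rV[R]_d -> R) : 'rV[R]_d -> R :=
  fun t => f (t + h) - f t.

Definition lattice_points (R : realType) (d : nat) (Omega : set 'rV[R]_d)
    (n : nat) : set 'rV[R]_d :=
  Omega `&` [set j | exists z : 'rV[int]_d, j = n%:R^-1 *: map_mx intr z].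

(* Equal to 0 on infinite sets, as [fset_set] is then empty. *)
Definition set_size (R : realType) (d : nat) (A : set 'rV[R]_d) : nat :=
  #|` fset_set A |.

Definition quad_var (R : realType) (d : nat) (T : Type)
    (Y : 'rV[R]_d -> T -> R) (Omega : set 'rV[R]_d) (h : 'rV[R]_d)
    (delta1 : R) (p n : nat) (w : T) : R :=
  (set_size (lattice_points Omega n))%:R^-1 *
  \sum_(j \in lattice_points Omega n)
    n%:R `^ delta1 *
      (iter p (increment (n%:R^-1 *: h)) (fun t => Y t w) j) ^+ 2.

Definition Ccoef (R : realType) (d : nat) (h : 'rV[R]_d) (p : nat)
    (delta : R) : R :=
  enorm h `^ delta *
  \sum_(i < p.+1) \sum_(j < p.+1)
    (-1) ^+ (i + j) * 'C(p, i)%:R * 'C(p, j)%:R * `|i%:R - j%:R| `^ delta.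

Definition c2_denom (R : realType) (d : nat) (h : 'rV[R]_d)
    (delta1 delta2 : R) (p q : nat) : R :=
  Ccoef h p delta2 - Ccoef h p delta1 / Ccoef h q delta1 * Ccoef h q delta2.

Definition c1_hat (R : realType) (d : nat) (T : Type)
    (Y : 'rV[R]_d -> T -> R) (Omega : set 'rV[R]_d) (h : 'rV[R]_d)
    (delta1 : R) (p n : nat) (w : T) : R :=
  quad_var Y Omega h delta1 p n w / Ccoef h p delta1.

Definition c2_hat (R : realType) (d : nat) (T : Type)
    (Y : 'rV[R]_d -> T -> R) (Omega : set 'rV[R]_d) (h : 'rV[R]_d)
    (delta1 delta2 : R) (p q n : nat) (w : T) : R :=
  n%:R `^ (delta2 - delta1) *
  ((quad_var Y Omega h delta1 p n w -
    Ccoef h p delta1 / Ccoef h q delta1 * quad_var Y Omega h delta1 q n w) /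
   c2_denom h delta1 delta2 p q).

(* Main.v *)
(** With [gamma = delta2 - delta1], the mean of [Q_n^p] is
    [c1 C_{p,delta1} + c2 n^{-gamma} C_{p,delta2}] as soon as [p > k], so both
    estimators converge once [n^gamma (Q_n^p - E Q_n^p)] tends to [0] almost
    surely; as [Var Q_n^p] is only [O(n^{-d})], variances do not suffice and all
    even moments are estimated.

    After rescaling, the covariances of the increments are mixed differences of
    order [2p] of [|.|^delta] at integer points; for [p] large they are summable
    over the lattice, so the covariance matrix [K] of the increments has bounded
    row sums.  Gaussian integration by parts gives, for [Q = sum_i X_i^2] and
    [c = E Q], [E (Q - c)^{r+1} = 2 r E (X^T K X (Q - c)^{r-1})], whence
    [E (Q - c)^{2r} = O(N^r)] with [N] the number of lattice points, which is of
    order [n^d].  Taking [r] with [r (d - 2 gamma) >= 2] makes the [2r]-th moments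
    of [n^gamma (Q_n^p - E Q_n^p)] summable.

    Up to the factor [|h|^delta], [C_{p,delta}] is a combination of the
    exponentials [m^delta], [m = 1..p], vanishing at [delta = 2, 4, .., 2p-2].  A
    nonzero combination of [n] distinct exponentials has at most [n - 1] real zeros,
    which yields [C_{p,delta} <> 0] for [delta] not an even integer and, with
    [q = p + 1], that the denominator of the second estimator does not vanish. *)

Require Import Defs.
From HB Require Import structures.
From mathcomp Require Import all_boot all_order all_algebra finmap.
From mathcomp Require Import ring lra zify.
From mathcomp Require Import all_classical all_reals all_analysis measurable_realfun.
From mathcomp Require mpoly.
Import (canonicals) mpoly.
Set Implicit Arguments.
Unset Strict Implicit.
Unset Printing Implicit Defensive.
Import Order.TTheory GRing.Theory Num.Theory.
Import numFieldNormedType.Exports.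
Local Open Scope classical_set_scope.
Local Open Scope ring_scope.

(** * Moments of the one-dimensional normal law *)

Lemma le_expR_fact (R : realType) (x : R) n : 0 <= x -> x ^+ n <= n`!%:R * expR x.
Proof.
move=> x0; case: n => [|n]; first by rewrite expr0 mul1r -expR0 ler_expR.
have := expR_ge1Dxn n x0.
rewrite -[X in _ -> X <= _]mulr1 -ler_pdivrMl ?ltr0n ?fact_gt0// mulr1 mulrC => h.
by rewrite (le_trans _ h)// lerDr.
Qed.

(** The Radon-Nikodym derivative of the normal law and [normal_pdf] have the same integral over
    every measurable set, hence agree almost everywhere; the general change of variables then takes
    this explicit form. *)
Lemma ge0_integral_normal_prob (R : realType) (m s : R) (f : measurableTypeR R -> \bar R) :
  s != 0 -> measurable_fun setT f -> (forall x, 0 <= f x)%E ->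
  (\int[normal_prob m s]_x f x =
   \int[lebesgue_measure]_x (f x * (normal_pdf m s x)%:E))%E.
Proof.
move=> s0 mf f0.
have dom := normal_prob_dominates m s.
rewrite -(Radon_Nikodym_SigmaFinite.change_of_variables dom)//.
apply: ae_eq_integral => //.
- apply: emeasurable_funM => //; apply: (measurable_int lebesgue_measure).
  exact: Radon_Nikodym_SigmaFinite.f_integrable.
- apply: emeasurable_funM => //; apply/measurable_EFinP.
  exact: measurable_normal_pdf.
- apply: ae_eqe_mul2l; apply: integral_ae_eq => //.
  + exact: Radon_Nikodym_SigmaFinite.f_integrable.
  + by apply/measurable_EFinP; exact: measurable_normal_pdf.
  + by move=> E _ mE; rewrite -Radon_Nikodym_SigmaFinite.f_integral.
Qed.

Lemma normal_funE (R : realType) (m s x : R) :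
  normal_fun m s x = expR (- ((x - m) ^+ 2 / (s ^+ 2 *+ 2))).
Proof. by rewrite /normal_fun mulNr. Qed.

Lemma normal_pdf_prod (R : realType) (m s x : R) : s != 0 ->
  normal_pdf m s x = normal_peak s * normal_fun m s x.
Proof. by move=> s0; rewrite normal_pdfE. Qed.

(** Doubling the standard deviation frees a factor [exp(- y^2 / c)], which absorbs any power of [y].
    This gives both the integrability of the moments and the decay of the boundary terms in the
    integration by parts. *)
Lemma expr_mul_normal_fun_le (R : realType) (m s : R) n : s != 0 ->
  exists2 C : R, 0 <= C & forall x,
    `|x - m| ^+ n * normal_fun m s x <= C * normal_fun m (2 * s) x.
Proof.
move=> s0; set v := s ^+ 2.
have v0 : 0 < v by rewrite exprn_even_gt0.
(* [c] solves [1 / (2 v) = 1 / c + 1 / (8 v)], where [8 v] is twice the variance of the wider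
   law. *)
set c := 8 * v / 3.
have c0 : 0 < c by rewrite /c; lra.
exists (1 + n`!%:R * c ^+ n) => [|x].
  by rewrite addr_ge0// mulr_ge0// exprn_ge0// /c; lra.
set y : R := `|x - m|.
have y0 : 0 <= y by exact: normr_ge0.
rewrite !normal_funE -[(x - m) ^+ 2](real_normK (num_real _)) -/y [(2 * s) ^+ 2]exprMn -/v.
have yn : y ^+ n <= 1 + (y ^+ 2) ^+ n.
  have [y1|y1] := leP y 1.
    by rewrite (le_trans (exprn_ile1 n y0 y1))// lerDl exprn_ge0// sqr_ge0.
  rewrite (@le_trans _ _ ((y ^+ 2) ^+ n))// ?lerDr//.
  by rewrite -exprM (ler_weXn2l (ltW y1))// leq_pmull.
have : y ^+ 2 / c >= 0 by rewrite divr_ge0 ?sqr_ge0// /c; lra.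
move=> /(le_expR_fact n).
rewrite expr_div_n ler_pdivrMr ?exprn_gt0// => h.
have split_ : - (y ^+ 2 / (v *+ 2)) =
    - (y ^+ 2 / c) - (y ^+ 2 / (2 ^+ 2 * v *+ 2)).
  rewrite /c; field; lra.
rewrite split_ expRD [leLHS]mulrA.
rewrite ler_wpM2r ?expR_ge0//.
rewrite (le_trans (ler_wpM2r (expR_ge0 _) yn))// mulrDl mul1r lerD//.
  by rewrite -[leRHS]expR0 ler_expR oppr_le0 divr_ge0 ?sqr_ge0// /c; lra.
by rewrite expRN ler_pdivrMr ?expR_gt0// (le_trans h)// mulrAC.
Qed.

Lemma integrable_normal_moment (R : realType) (m s : R) n : s != 0 ->
  lebesgue_measure.-integrable setT
    (fun x : R => ((x - m) ^+ n * normal_pdf m s x)%:E).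
Proof.
move=> s0; have [C C0 hC] := @expr_mul_normal_fun_le _ m s n s0.
have s20 : 2 * s != 0 by rewrite mulf_neq0// pnatr_eq0.
pose D := normal_peak s * C / normal_peak (2 * s).
have p0 := normal_peak_gt0 s0; have p20 := normal_peak_gt0 s20.
have iD : lebesgue_measure.-integrable setT
    (fun x : R => (D%:E * (normal_pdf m (2 * s) x)%:E)%E).
  by apply: integrableZl => //; exact: integrable_normal_pdf.
apply: le_integrable iD => //.
  apply/measurable_EFinP; apply: measurable_funM.
    by apply: measurable_funX; exact: measurable_funB.
  exact: measurable_normal_pdf.
move=> x _; rewrite -EFinM !abse_EFin lee_fin.
rewrite [leRHS]ger0_norm; last first.
  by rewrite mulr_ge0 ?normal_pdf_ge0// divr_ge0 ?mulr_ge0//; exact: ltW.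
rewrite normrM (ger0_norm (normal_pdf_ge0 _ _ _)) normrX.
rewrite !normal_pdf_prod// mulrCA [leRHS]mulrA /D divfK ?gt_eqF// -[leRHS]mulrA.
by rewrite ler_wpM2l// ltW.
Qed.

Lemma is_derive1M (R : realType) (f g : R -> R) (x a b : R) :
  is_derive x 1 f a -> is_derive x 1 g b ->
  is_derive x 1 (fun y => f y * g y) (f x * b + a * g x).
Proof.
by move=> df dg; apply: is_derive_eq (is_deriveM df dg) _; rewrite (mulrC a).
Qed.

Lemma is_derive1Z (R : realType) (f : R -> R) (c x a : R) :
  is_derive x 1 f a -> is_derive x 1 (fun y => c * f y) (c * a).
Proof. by move=> df; exact: is_deriveZ. Qed.

(** Integrated over the line, this derivative is the recursion between the moments of orders [n.+1]
    and [n.-1]. At [n = 0] the factor [n%:R] removes the term with the truncated exponent. *)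
Lemma is_derive_normal_moment (R : realType) (m s : R) n (x : R) : s != 0 ->
  is_derive x (1 : R) (fun x : R => - s ^+ 2 * ((x - m) ^+ n * normal_pdf m s x))
    ((x - m) ^+ n.+1 * normal_pdf m s x -
     n%:R * s ^+ 2 * ((x - m) ^+ n.-1 * normal_pdf m s x)).
Proof.
move=> s0; have -> : normal_pdf m s = fun x => normal_peak s * normal_fun m s x.
  by apply/funext => y; rewrite normal_pdf_prod.
rewrite /normal_fun.
have : is_derive x (1 : R) (fun x : R => - (x - m) ^+ 2 / (s ^+ 2 *+ 2)) (- (x - m) / s ^+ 2).
  apply: is_derive_eq.
  rewrite /GRing.scale/=; field.
  exact: s0.
move=> dq.
have de : is_derive x (1 : R) (fun x : R => expR (- (x - m) ^+ 2 / (s ^+ 2 *+ 2)))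
    (expR (- (x - m) ^+ 2 / (s ^+ 2 *+ 2)) * (- (x - m) / s ^+ 2)).
  exact: (is_derive1_comp (is_derive_expR _) dq).
have dn : is_derive x (1 : R) (fun x : R => (x - m) ^+ n)
    (n%:R * (x - m) ^+ n.-1).
  have -> : (fun x : R => (x - m) ^+ n) = (fun x : R => x - m) ^+ n.
    by apply/funext => y; rewrite exprfctE.
  by apply: is_derive_eq; rewrite subr0 /GRing.scale/= mulr1.
apply: is_derive_eq (is_derive1Z _ (is_derive1M dn (is_derive1Z _ de))) _.
by move: (expR _) => e; case: n {dn} => [|n] /=; rewrite ?expr0
  ?[_ ^+ n.+2]exprS ?[_ ^+ n.+1]exprS; field.
Qed.

(** The fundamental theorem of calculus on growing intervals centred at [c], followed by dominated
    convergence with dominating function [|f|]. *)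
Lemma Rintegral_derive_vanishing (R : realType) (f F : R -> R) (c : R) :
  (forall x, is_derive x (1 : R) F (f x)) -> continuous f ->
  lebesgue_measure.-integrable setT (EFin \o f) ->
  F (c + n.+1%:R) - F (c - n.+1%:R) @[n --> \oo] --> (0 : R) ->
  \int[lebesgue_measure]_x f x = 0.
Proof.
move=> dF cf intf F0.
have [mf _] := integrableP _ _ _ intf.
pose D n := `[c - n.+1%:R, c + n.+1%:R]%classic : set R.
pose g n x := ((f \_ (D n)) x)%:E.
have mg n : measurable_fun setT (g n).
  apply/measurable_EFinP/measurable_restrict => //; first exact: measurable_itv.
  by rewrite setTI; apply: measurable_funTS; exact/measurable_EFinP.
have cvg_g : {ae lebesgue_measure, forall x, setT x -> g ^~ x @ \oo --> (f x)%:E}.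
  apply: aeW => x _; apply: cvg_near_cst.
  near=> n; rewrite /g patchE mem_set// /D/= in_itv/=.
  have : `|x - c| <= n%:R by near: n; exact: nbhs_infty_ger.
  by rewrite ler_norml => /andP[h1 h2]; rewrite -natr1; apply/andP; split; lra.
have ig : lebesgue_measure.-integrable setT (abse \o (EFin \o f)) by exact: integrable_abse.
have dom : {ae lebesgue_measure, forall x n, setT x -> (`|g n x| <= (abse \o (EFin \o f)) x)%E}.
  apply: aeW => x n _ /=; rewrite lee_fin patchE; case: ifP => // _.
  by rewrite normr0.
have [_ _] := @dominated_convergence _ _ R lebesgue_measure setT measurableT
  g (EFin \o f) (abse \o (EFin \o f)) mg mf cvg_g ig dom.
have -> : (fun n => \int[lebesgue_measure]_x (g n x))%E =
          (fun n => (F (c + n.+1%:R) - F (c - n.+1%:R))%:E).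
  apply/funext => n; rewrite EFinB.
  have cF : continuous F.
    by move=> x; apply/differentiable_continuous/derivable1_diffP; have [] := dF x.
  rewrite -(@continuous_FTC2 _ f F).
  - by rewrite [RHS]integral_mkcond; apply: eq_integral => x _; rewrite /g restrict_EFin.
  - by rewrite ltrBlDr -addrA ltrDl addr_gt0// ltr0Sn.
  - exact: continuous_subspaceT.
  - split.
    + by move=> x _; have [] := dF x.
    + exact/cvg_at_right_filter/cF.
    + exact/cvg_at_left_filter/cF.
  - by move=> x _; rewrite derive1E; exact: derive_val.
move=> cvgI; rewrite /Rintegral.
have F0E : (F (c + n.+1%:R) - F (c - n.+1%:R))%:E @[n --> \oo] --> (0 : R)%:E.
  by apply: cvg_EFin => //; exact: nearW.
by rewrite -(cvg_unique _ F0E cvgI).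
Unshelve. all: by end_near. Qed.

Lemma normal_moment_rec (R : realType) (m s : R) n : s != 0 ->
  \int[lebesgue_measure]_x ((x - m) ^+ n.+1 * normal_pdf m s x) =
  n%:R * s ^+ 2 * \int[lebesgue_measure]_x ((x - m) ^+ n.-1 * normal_pdf m s x).
Proof.
move=> s0.
have int1 k : lebesgue_measure.-integrable setT
    (EFin \o (fun x : R => (x - m) ^+ k * normal_pdf m s x)).
  exact: integrable_normal_moment.
have int2 : lebesgue_measure.-integrable setT
    (EFin \o (fun x : R => n%:R * s ^+ 2 * ((x - m) ^+ n.-1 * normal_pdf m s x))).
  by apply: (integrableZl measurableT (n%:R * s ^+ 2) (int1 n.-1)).
apply/eqP; rewrite -RintegralZl// -subr_eq0 -RintegralB//; apply/eqP.
apply: (@Rintegral_derive_vanishing R _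
  (fun x : R => - s ^+ 2 * ((x - m) ^+ n * normal_pdf m s x)) m).
- by move=> x; exact: is_derive_normal_moment.
- have cp := @continuous_normal_pdf R m s s0.
  have cX k x : (y - m) ^+ k @[y --> x] --> (x - m) ^+ k.
    apply: (cvg_comp (fun y : R => y - m) (fun y => y ^+ k)).
      by apply: (@cvgB _ R^o) => //; [exact: cvg_id|exact: cvg_cst].
    exact: exprn_continuous.
  move=> x; apply: (@cvgB _ R^o).
    by apply: cvgM; [exact: cX|exact: cp].
  apply: cvgM; first exact: cvg_cst.
  by apply: cvgM; [exact: cX|exact: cp].
- exact: (integrableB measurableT (int1 n.+1) int2).
(* The antiderivative stays bounded after multiplication by one more factor [|x - m|], so its values
   at [m + k.+1] and [m - k.+1] are [O(1 / k)]. *)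
- have [C C0 hC] := @expr_mul_normal_fun_le _ m s n.+1 s0.
  pose K := s ^+ 2 * (normal_peak s * C).
  have bnd x : `|x - m| * `|- s ^+ 2 * ((x - m) ^+ n * normal_pdf m s x)| <= K.
    rewrite !normrM normrN normrX (real_normK (num_real _)) normrX.
    rewrite (ger0_norm (normal_pdf_ge0 _ _ _)) normal_pdf_prod//.
    rewrite mulrCA ler_wpM2l ?sqr_ge0// mulrA -exprS mulrCA.
    rewrite ler_wpM2l ?normal_peak_ge0// (le_trans (hC x))// ler_piMr//.
    by rewrite normal_funE -expR0 ler_expR oppr_le0 divr_ge0 ?sqr_ge0// mulrn_wge0 ?sqr_ge0.
  apply/cvgr0Pnorm_le => e e0; near=> k.
  have k1 : 0 < (k.+1%:R : R) by rewrite ltr0Sn.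
  have hk : 2 * K / e <= k.+1%:R.
    rewrite -[leRHS]natr1; apply: (@le_trans _ _ (k%:R)); last by rewrite lerDl.
    by near: k; exact: nbhs_infty_ger.
  rewrite ler_pdivrMr// mulrC in hk.
  have h1 := bnd (m + k.+1%:R); have h2 := bnd (m - k.+1%:R).
  have e1 : m + k.+1%:R - m = k.+1%:R by rewrite addrAC subrr add0r.
  have e2 : m - k.+1%:R - m = - k.+1%:R by rewrite addrAC subrr add0r.
  rewrite e1 (ger0_norm (ltW k1)) in h1; rewrite e2 normrN (ger0_norm (ltW k1)) in h2.
  rewrite e1 e2 (le_trans (ler_normB _ _))// -(ler_pM2l k1) mulrDr.
  lra.
Unshelve. all: by end_near. Qed.

(** Transfer to the law of [X], then to its density, is first done for nonnegative functions; the
    general case splits [g] into its positive and negative parts. *)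
Lemma integral_normal_law (R : realType) (disp : measure_display)
    (T : measurableType disp) (P : probability T R) (X : {RV P >-> R})
    (m s : R) (g : R -> R) : s != 0 ->
  (forall A, measurable A -> P (X @^-1` A) = normal_prob m s A) ->
  measurable_fun setT g ->
  lebesgue_measure.-integrable setT (fun x => (g x * normal_pdf m s x)%:E) ->
  P.-integrable setT (EFin \o (g \o X)) /\
  \int[P]_w g (X w) = \int[lebesgue_measure]_x (g x * normal_pdf m s x).
Proof.
move=> s0 law mg ig.
have ge0 (f : R -> \bar R) : measurable_fun [set: R] f -> (forall x, 0 <= f x)%E ->
    (\int[P]_w f (X w) = \int[lebesgue_measure]_x (f x * (normal_pdf m s x)%:E))%E.
  move=> mf f0; rewrite -ge0_integral_normal_prob//.
  (* [normal_prob] lives on [measurableTypeR R], whose display differs from the one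
     of the codomain of [X]; hence the repackaging. *)
  pose mX : @measurable_fun _ _ T (measurableTypeR R) setT X := measurable_funPT X.
  pose X' : {mfun T >-> measurableTypeR R} :=
    HB.pack (X : T -> measurableTypeR R) (isMeasurableFun.Build _ _ _ _ _ mX).
  rewrite -[LHS](@ge0_integral_distribution _ _ T (measurableTypeR R) R P X')//.
  by apply: eq_measure_integral => A mA _; exact: law.
have pdf0 x : (0 <= (normal_pdf m s x)%:E)%E by rewrite lee_fin normal_pdf_ge0.
have mX : measurable_fun setT X by [].
have mgX : measurable_fun setT (EFin \o (g \o X)).
  by apply/measurable_EFinP; exact: measurableT_comp.
split.
  apply/integrableP; split => //.
  rewrite (ge0 (fun x => `|(g x)%:E|)%E)//.
    have [_] := integrableP _ _ _ ig.
    congr (_ < _)%E; apply: eq_integral => x _.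
    by rewrite EFinM abseM [X in (_ * X)%E]gee0_abs.
  by apply: measurableT_comp => //; exact/measurable_EFinP.
have mgE : measurable_fun [set: R] (EFin \o g) by exact/measurable_EFinP.
congr fine; rewrite [LHS]integralE [RHS]integralE; congr (_ - _)%E.
  transitivity (\int[lebesgue_measure]_x ((EFin \o g)^\+ x * (normal_pdf m s x)%:E))%E.
    rewrite -ge0; [|exact: measurable_funepos|exact: funepos_ge0].
    by apply: eq_integral => w _; rewrite !funeposE.
  apply: eq_integral => x _; rewrite !funeposE/= EFinM muleC [in RHS]muleC.
  by rewrite maxe_pMr// mule0.
transitivity (\int[lebesgue_measure]_x ((EFin \o g)^\- x * (normal_pdf m s x)%:E))%E.
  rewrite -ge0; [|exact: measurable_funeneg|exact: funeneg_ge0].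
  by apply: eq_integral => w _; rewrite !funenegE.
apply: eq_integral => x _; rewrite !funenegE [in RHS]EFinM muleC [in RHS]muleC -muleN.
by rewrite maxe_pMr// mule0.
Qed.

(** The recursion covers the degenerate law too: if [s = 0] then [X = m] almost surely, and both
    sides vanish. *)
Lemma gaussian_moments (R : realType) (disp : measure_display)
    (T : measurableType disp) (P : probability T R) (X : {RV P >-> R}) :
  gaussian P X ->
  exists m s : R,
    (forall n, P.-integrable setT (EFin \o (fun w => (X w - m) ^+ n))) /\
    forall n, \int[P]_w ((X w - m) ^+ n.+1) =
      n%:R * s ^+ 2 * \int[P]_w ((X w - m) ^+ n.-1).
Proof.
move=> [m [s [_ law]]]; exists m, s; have [s0|s0] := eqVneq s 0; last first.
  have {}law A : measurable A -> P (X @^-1` A) = normal_prob m s A.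
    by move=> mA; rewrite law// (negbTE s0).
  have mX n : measurable_fun [set: R] (fun x : R => (x - m) ^+ n).
    by apply: measurable_funX; exact: measurable_funB.
  have h n := integral_normal_law s0 law (mX n) (integrable_normal_moment m n s0).
  split=> n; first by have [] := h n.
  have [_ ->] := h n.+1; have [_ ->] := h n.-1.
  exact: normal_moment_rec.
have Xm : {ae P, forall w, X w = m}.
  have mC : measurable (~` [set m] : set R) by apply: measurableC; exact: measurable_set1.
  exists (X @^-1` (~` [set m])); split => //.
  - by rewrite -[X in measurable X]setTI; exact: measurable_funPT.
  - by rewrite law// s0 eqxx diracE memNset//; exact.
have Xn n : ae_eq P setT (fun w => ((X w - m) ^+ n)%:E) (cst ((n == 0%N)%:R)%:E).
  by apply: filterS Xm => w + _ => /= ->; rewrite subrr expr0n.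
have mX n : measurable_fun setT (EFin \o (fun w => (X w - m) ^+ n)).
  apply/measurable_EFinP; apply: (@measurable_funX _ _ _ _ (fun w => X w - m)).
  exact: measurable_funB.
split => n.
  apply/integrableP; split => //.
  rewrite (ae_eq_integral (cst `|((n == 0%N)%:R : R)|%:E))//.
  - rewrite integral_cst//; apply: lte_mul_pinfty => //.
    exact: (le_lt_trans (probability_le1 P measurableT) (ltry 1)).
  - exact: measurableT_comp.
  - by apply: filterS (Xn n) => w h /h /= [->].
rewrite s0 expr0n mulr0 mul0r /Rintegral (ae_eq_integral (cst 0%E))//.
  by rewrite integral0.
exact: (mX n.+1).
Qed.

(** The parameters of the law are eliminated: the recursion at [n = 0] forces [m = 0], and at
    [n = 1] it identifies [s ^+ 2] with the second moment. What remains is an identity between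
    moments of [X] alone, which can be polarized. *)
Lemma centered_gaussian_moments (R : realType) (disp : measure_display)
    (T : measurableType disp) (P : probability T R) (X : {RV P >-> R}) :
  gaussian P X -> \int[P]_w X w = 0 ->
  (forall n, P.-integrable setT (EFin \o (fun w => X w ^+ n))) /\
  forall n, \int[P]_w (X w ^+ n.+1) =
    n%:R * \int[P]_w (X w ^+ 2) * \int[P]_w (X w ^+ n.-1).
Proof.
move=> /gaussian_moments[m [s [intX momX]]] EX.
have Rcst (r : R) : \int[P]_w r = r.
  have P1 : fine (P setT) = 1 by rewrite probability_setT.
  by rewrite Rintegral_cst// -[RHS]mulr1 -[in RHS]P1.
have m0 : m = 0.
  have := momX 0%N; rewrite /= !mul0r.
  have i0 : P.-integrable setT (EFin \o (cst (- m))) by exact: finite_measure_integrable_cst.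
  have e1 : \int[P]_w (X w) = \int[P]_w ((X w - m) ^+ 1) - - m.
    rewrite -[X in _ - X]Rcst -RintegralB//.
    by apply: eq_Rintegral => w _; rewrite expr1 opprK subrK.
  have -> : \int[P]_w ((X w - m) ^+ 1) = \int[P]_w (X w) - m.
    by rewrite e1 opprK addrK.
  by rewrite EX sub0r => /eqP; rewrite oppr_eq0 => /eqP.
subst m.
have e n w : (X w - 0) ^+ n = X w ^+ n by rewrite subr0.
split=> n.
  by have := intX n; apply: eq_integrable => // w _ /=; rewrite e.
have eI k : \int[P]_w ((X w - 0) ^+ k) = \int[P]_w (X w ^+ k).
  by apply: eq_Rintegral => w _; rewrite e.
have := momX n; rewrite !eI => ->.
have := momX 1%N; rewrite !eI /= => ->.
have -> : \int[P]_w (X w ^+ 0) = 1.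
  by rewrite -[RHS]Rcst; apply: eq_Rintegral => w _; rewrite expr0.
by rewrite mul1r mulr1.
Qed.

(** * Gaussian integration by parts *)

(** This class is stable under sums and products, so every polynomial in the Gaussian variables is
    integrable without further estimates. *)
Definition all_moments (R : realType) (disp : measure_display)
    (T : measurableType disp) (P : probability T R) (f : T -> R) : Prop :=
  measurable_fun setT f /\
  forall n, P.-integrable setT (EFin \o (fun w => f w ^+ n)).

Section all_moments_theory.
Context (R : realType) (disp : measure_display) (T : measurableType disp).
Variable P : probability T R.
Implicit Types f g : T -> R.
Local Notation am := (all_moments P).

Lemma all_moments_integrable f : am f -> P.-integrable setT (EFin \o f).
Proof. by move=> [_ /(_ 1%N)]. Qed.

Lemma all_moments_cst (c : R) : am (fun=> c).
Proof. by split=> // n; exact: finite_measure_integrable_cst. Qed.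

Lemma integrableM_sqr f g :
  measurable_fun setT f -> measurable_fun setT g ->
  P.-integrable setT (EFin \o (fun w => f w ^+ 2)) ->
  P.-integrable setT (EFin \o (fun w => g w ^+ 2)) ->
  P.-integrable setT (EFin \o (fun w => f w * g w)).
Proof.
move=> mf mg if2 ig2.
have ifg := integrableD measurableT if2 ig2.
apply: le_integrable ifg => //.
  by apply/measurable_EFinP; exact: measurable_funM.
move=> w _ /=; rewrite lee_fin normrM [leRHS]ger0_norm ?addr_ge0 ?sqr_ge0//.
rewrite -(real_normK (num_real (f w))) -(real_normK (num_real (g w))).
have := sqr_ge0 (`|f w| - `|g w|).
have := mulr_ge0 (normr_ge0 (f w)) (normr_ge0 (g w)).
lra.
Qed.

Lemma all_momentsM f g : am f -> am g -> am (fun w => f w * g w).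
Proof.
move=> [mf af] [mg ag]; split=> [|n]; first exact: measurable_funM.
have e h m : (fun w : T => (h w ^+ m) ^+ 2) = (fun w => h w ^+ (m * 2) : R).
  by apply/funext => w; rewrite exprM.
have := @integrableM_sqr (fun w => f w ^+ n) (fun w => g w ^+ n).
rewrite !e => /(_ (measurable_funX n mf) (measurable_funX n mg) (af _) (ag _)).
by congr (P.-integrable _ _); apply/funext => w /=; rewrite exprMn.
Qed.

Lemma all_momentsX f n : am f -> am (fun w => f w ^+ n).
Proof.
move=> af; elim: n => [|n ih]; first exact: all_moments_cst.
have -> : (fun w => f w ^+ n.+1) = (fun w => f w * f w ^+ n).
  by apply/funext => w; rewrite exprS.
exact: all_momentsM.
Qed.

Lemma all_momentsD f g : am f -> am g -> am (fun w => f w + g w).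
Proof.
move=> af ag; split=> [|n]; first by apply: measurable_funD; [case: af|case: ag].
have -> : EFin \o (fun w => (f w + g w) ^+ n) = (fun w => (\sum_(i < n.+1)
    (('C(n, i)%:R * (f w ^+ (n - i) * g w ^+ i))%:E)))%E.
  apply/funext => w /=; rewrite exprDn -sumEFin; apply: eq_bigr => i _.
  by rewrite mulr_natl.
apply: integrable_sum => // i _.
apply: (@all_moments_integrable (fun w => 'C(n, i)%:R * (f w ^+ (n - i) * g w ^+ i))).
by do !apply: all_momentsM; [exact: all_moments_cst|exact: all_momentsX..].
Qed.

Lemma all_moments_sum (I : Type) (r : seq I) (F : I -> T -> R) :
  (forall i, am (F i)) -> am (fun w => \sum_(i <- r) F i w).
Proof.
move=> aF; elim: r => [|i r ih].
  by under eq_fun do rewrite big_nil; exact: all_moments_cst.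
by under eq_fun do rewrite big_cons; exact: all_momentsD.
Qed.

Lemma expect_cst (c : R) : \int[P]_w c = c.
Proof.
have P1 : fine (P setT) = 1 by rewrite probability_setT.
by rewrite Rintegral_cst// -[RHS]mulr1 -[in RHS]P1.
Qed.

Lemma expectD f g : am f -> am g ->
  \int[P]_w (f w + g w) = \int[P]_w f w + \int[P]_w g w.
Proof. by move=> /all_moments_integrable ? /all_moments_integrable ?; exact: RintegralD. Qed.

Lemma expectZ (c : R) f : am f -> \int[P]_w (c * f w) = c * \int[P]_w f w.
Proof. by move=> /all_moments_integrable ?; exact: RintegralZl. Qed.

Lemma expect_sum (I : Type) (r : seq I) (F : I -> T -> R) :
  (forall i, am (F i)) ->
  \int[P]_w (\sum_(i <- r) F i w) = \sum_(i <- r) \int[P]_w F i w.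
Proof.
move=> aF; elim: r => [|i r ih].
  by under eq_Rintegral do rewrite big_nil; rewrite big_nil expect_cst.
under eq_Rintegral do rewrite big_cons.
by rewrite big_cons expectD ?ih//; exact: all_moments_sum.
Qed.

Lemma expect_le f g : am f -> am g -> (forall w, f w <= g w) ->
  \int[P]_w f w <= \int[P]_w g w.
Proof.
move=> /all_moments_integrable ? /all_moments_integrable ? fg.
by apply: le_Rintegral.
Qed.

End all_moments_theory.

Ltac all_moments_tac := repeat first
  [ assumption | exact: all_moments_cst | apply: all_moments_sum => ?
  | apply: all_momentsD | apply: all_momentsM | apply: all_momentsX ].

(** Used at [t = 0] to compare the linear coefficients of two polynomials known only through their
    values. *)
Lemma horner_eq_deriv (R : realType) (p q : {poly R}) :
  (forall t, p.[t] = q.[t]) -> forall t, p^`().[t] = q^`().[t].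
Proof.
move=> pq t; have e : horner p = horner q by apply/funext.
have := is_derive_poly p t; rewrite e => /@derive_val <-.
by have := is_derive_poly q t => /@derive_val <-.
Qed.

Section gaussian_integration_by_parts.
Context (R : realType) (disp : measure_display) (T : measurableType disp).
Variables (P : probability T R) (V : lmodType R) (xi : V -> T -> R).
Hypothesis xi_linear : forall t u v w, xi (t *: u + v) w = t * xi u w + xi v w.
Hypothesis xi_moments : forall u, all_moments P (xi u).
Hypothesis xi_rec : forall u n, \int[P]_w (xi u w ^+ n.+1) =
  n%:R * \int[P]_w (xi u w ^+ 2) * \int[P]_w (xi u w ^+ n.-1).

Let K u v := \int[P]_w (xi u w * xi v w).

(** As a function of [t] this is the expectation of [xi (t *: b + a) ^+ n * f], expanded by the
    binomial formula. Identities in [t] can thus be differentiated at 0 with no derivative taken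
    under the integral. *)
Let momp (a b : V) n (f : T -> R) : {poly R} :=
  \poly_(i < n.+1)
    ('C(n, i)%:R * \int[P]_w (xi b w ^+ i * xi a w ^+ (n - i) * f w)).

Let horner_momp a b n f t : all_moments P f ->
  (momp a b n f).[t] = \int[P]_w (xi (t *: b + a) w ^+ n * f w).
Proof.
move=> af; rewrite /momp horner_poly.
transitivity (\int[P]_w (\sum_(i < n.+1)
    (t ^+ i * 'C(n, i)%:R * (xi b w ^+ i * xi a w ^+ (n - i) * f w)))); last first.
  apply: eq_Rintegral => w _; rewrite xi_linear addrC exprDn mulr_suml.
  by apply: eq_bigr => i _; rewrite exprMn -mulr_natr; ring.
rewrite expect_sum => [|i]; last by all_moments_tac.
apply: eq_bigr => i _; rewrite expectZ; last by all_moments_tac.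
by rewrite mulrC mulrA.
Qed.

Let deriv_momp a b n f :
  (momp a b n f)^`().[0] = n%:R * \int[P]_w (xi b w * xi a w ^+ n.-1 * f w).
Proof.
rewrite -[0]/(0 : R) horner_coef0 coef_deriv mulr1n coef_poly.
case: n => [|n]; first by rewrite mul0r.
by rewrite bin1 subn1.
Qed.

Let momp0 a b n f : all_moments P f ->
  (momp a b n f).[0] = \int[P]_w (xi a w ^+ n * f w).
Proof. by move=> af; rewrite horner_momp// scale0r add0r. Qed.

Let K_linear u a b t : K u (t *: b + a) = t * K u b + K u a.
Proof.
rewrite /K -expectZ; last by all_moments_tac.
rewrite -expectD; [|by all_moments_tac..].
by apply: eq_Rintegral => w _; rewrite xi_linear; ring.
Qed.

Let KC u v : K u v = K v u.
Proof. by apply: eq_Rintegral => w _; rewrite mulrC. Qed.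

(** Polarization of [xi_rec]: applied to [t *: u + a] and differentiated at [t = 0], it expresses
    [(m + 1) E[u a^m]] through [E[a^(m-1)]] and [E[u a^(m-2)]]. The induction hypothesis and
    [xi_rec] for [a] turn the latter into a multiple of [E[a^(m-1)]]. *)
Lemma expect_mul_power u a m :
  \int[P]_w (xi u w * xi a w ^+ m) =
  m%:R * K u a * \int[P]_w (xi a w ^+ m.-1).
Proof.
elim/ltn_ind: m => m ih; have a1 := all_moments_cst P 1.
have pq t : (momp a u m.+1 (fun=> 1)).[t] =
    (m%:R *: (momp a u 2 (fun=> 1) * momp a u m.-1 (fun=> 1))).[t].
  rewrite hornerZ hornerM !horner_momp//.
  under eq_Rintegral do rewrite mulr1.
  under [X in _ = _ * (X * _)]eq_Rintegral do rewrite mulr1.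
  under [X in _ = _ * (_ * X)]eq_Rintegral do rewrite mulr1.
  by rewrite xi_rec mulrA.
have := horner_eq_deriv pq 0; rewrite derivZ derivM hornerZ hornerD !hornerM.
rewrite !deriv_momp !momp0//=.
have e (f : T -> R) : \int[P]_w (f w * 1) = \int[P]_w f w.
  by apply: eq_Rintegral => w _; rewrite mulr1.
rewrite !e.
have -> : \int[P]_w (xi u w * xi a w ^+ 1) = K u a.
  by apply: eq_Rintegral => w _; rewrite expr1.
move=> main; apply: (mulfI (x := m.+1%:R)); first by rewrite pnatr_eq0.
rewrite main; case: m ih {pq main} => [_|[_|m ih]]; rewrite ?mul0r ?mulr0//=.
- ring.
- rewrite ih// (xi_rec a m) -!natr1; ring.
Qed.

(* [g] plays the role of the derivative of [f] in the direction [K u].  Testing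
   against the powers [xi a ^+ m] makes the property stable under multiplication
   by [xi b]: take the coefficient of [t] after replacing [a] by [t *: b + a]. *)
Definition ibp u (f g : T -> R) := forall a m,
  \int[P]_w (xi u w * xi a w ^+ m * f w) =
  m%:R * K u a * \int[P]_w (xi a w ^+ m.-1 * f w) + \int[P]_w (xi a w ^+ m * g w).

Lemma ibp_cst u c : ibp u (fun=> c) (fun=> 0).
Proof.
move=> a m.
have e (f : T -> R) d : all_moments P f -> \int[P]_w (f w * d) = \int[P]_w f w * d.
  by move=> af; rewrite mulrC -expectZ//; apply: eq_Rintegral => w _; rewrite mulrC.
by rewrite !e ?mulr0 ?addr0 ?expect_mul_power ?mulrA//; all_moments_tac.
Qed.

Lemma ibpM u b f g : all_moments P f -> all_moments P g -> ibp u f g ->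
  ibp u (fun w => xi b w * f w) (fun w => K u b * f w + xi b w * g w).
Proof.
move=> af ag fg a m.
have au : all_moments P (fun w => xi u w * f w) by all_moments_tac.
(* The hypothesis is used with exponent [m.+1]: differentiation in the direction [b] lowers it to
   [m] and produces the factor [m.+1], cancelled below. *)
have pq t : (momp a b m.+1 (fun w => xi u w * f w)).[t] =
    (m.+1%:R *: (((K u b) *: 'X + (K u a)%:P) * momp a b m f) + momp a b m.+1 g).[t].
  rewrite !hornerE !horner_momp//; have := fg (t *: b + a) m.+1.
  rewrite /= K_linear [t * _]mulrC => <-.
  by apply: eq_Rintegral => w _; ring.
have := horner_eq_deriv pq 0.
rewrite derivD derivZ derivM derivD derivZ derivX derivC !hornerE !deriv_momp !momp0//=.
move=> main; apply: (mulfI (x := m.+1%:R)); first by rewrite pnatr_eq0.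
transitivity (m.+1%:R * \int[P]_w (xi b w * xi a w ^+ m * (xi u w * f w))).
  by congr (_ * _); apply: eq_Rintegral => w _; ring.
rewrite main.
have -> : \int[P]_w (xi a w ^+ m * (K u b * f w + xi b w * g w)) =
   K u b * \int[P]_w (xi a w ^+ m * f w) + \int[P]_w (xi b w * xi a w ^+ m * g w).
  rewrite -expectZ -?expectD; [|by all_moments_tac..].
  by apply: eq_Rintegral => w _; ring.
have -> : \int[P]_w (xi a w ^+ m.-1 * (xi b w * f w)) =
    \int[P]_w (xi b w * xi a w ^+ m.-1 * f w).
  by apply: eq_Rintegral => w _; ring.
ring.
Qed.

Lemma ibpD u f1 g1 f2 g2 : all_moments P f1 -> all_moments P g1 ->
  all_moments P f2 -> all_moments P g2 -> ibp u f1 g1 -> ibp u f2 g2 ->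
  ibp u (fun w => f1 w + f2 w) (fun w => g1 w + g2 w).
Proof.
move=> af1 ag1 af2 ag2 h1 h2 a m.
have e (F f g : T -> R) : all_moments P F -> all_moments P f -> all_moments P g ->
    \int[P]_w (F w * (f w + g w)) = \int[P]_w (F w * f w) + \int[P]_w (F w * g w).
  move=> aF af ag; rewrite -expectD; [|by all_moments_tac..].
  by apply: eq_Rintegral => w _; rewrite mulrDr.
rewrite !e; [|by all_moments_tac..].
by rewrite h1 h2; ring.
Qed.

Lemma ibpZ u c f g : all_moments P f -> all_moments P g -> ibp u f g ->
  ibp u (fun w => c * f w) (fun w => c * g w).
Proof.
move=> af ag h a m.
have e (F f0 : T -> R) : all_moments P F -> all_moments P f0 ->
    \int[P]_w (F w * (c * f0 w)) = c * \int[P]_w (F w * f0 w).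
  move=> aF af0; rewrite -expectZ; last by all_moments_tac.
  by apply: eq_Rintegral => w _; rewrite mulrCA.
rewrite !e; [|by all_moments_tac..].
by rewrite h; ring.
Qed.

Lemma ibp_sum u (I : Type) (r : seq I) (F G : I -> T -> R) :
  (forall i, all_moments P (F i)) -> (forall i, all_moments P (G i)) ->
  (forall i, ibp u (F i) (G i)) ->
  ibp u (fun w => \sum_(i <- r) F i w) (fun w => \sum_(i <- r) G i w).
Proof.
move=> aF aG FG; elim: r => [|i r ih].
  have e (H : I -> T -> R) : (fun w => \sum_(i <- [::]) H i w) = (fun=> 0).
    by apply/funext => w; rewrite big_nil.
  by rewrite !e; exact: ibp_cst.
have e (H : I -> T -> R) : (fun w => \sum_(j <- i :: r) H j w) =
    (fun w => H i w + \sum_(j <- r) H j w).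
  by apply/funext => w; rewrite big_cons.
by rewrite !e; apply: ibpD => //; all_moments_tac.
Qed.

(** * Even moments of a centred quadratic form *)

Section centered_quadratic_form.
Context (I : finType) (e : I -> V) (c : R).

Let Q w := \sum_i xi (e i) w ^+ 2.

Let all_moments_centeredX r : all_moments P (fun w => (Q w - c) ^+ r).
Proof.
apply: all_momentsX; apply: all_momentsD; last exact: all_moments_cst.
by apply: all_moments_sum => i; all_moments_tac.
Qed.

(** Chain rule for the power of a quadratic polynomial, by induction on [r]: [(Q - c)^(r+1)] is the
    sum of the [xi_i (xi_i f)] minus [c f], with [f = (Q - c)^r], and [ibpM] applies twice to each
    product. *)
Lemma ibp_centered_power u r :
  ibp u (fun w => (Q w - c) ^+ r)
    (fun w => (2 * r)%:R * (\sum_i K u (e i) * xi (e i) w) * (Q w - c) ^+ r.-1).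
Proof.
elim: r => [|r ih].
  have -> : (fun w => (Q w - c) ^+ 0) = fun=> 1.
    by apply/funext => w; rewrite expr0.
  rewrite muln0; have -> : (fun w => 0%:R * (\sum_i K u (e i) * xi (e i) w) *
      (Q w - c) ^+ 0.-1) = fun=> 0 by apply/funext => w; rewrite !mul0r.
  exact: ibp_cst.
pose f w := (Q w - c) ^+ r.
pose g w := (2 * r)%:R * (\sum_i K u (e i) * xi (e i) w) * (Q w - c) ^+ r.-1.
have af : all_moments P f by exact: all_moments_centeredX.
have ag : all_moments P g.
  apply: all_momentsM; last exact: all_moments_centeredX.
  by all_moments_tac.
have fg : ibp u f g by [].
pose F i w := xi (e i) w * (xi (e i) w * f w).
pose G i w := K u (e i) * (xi (e i) w * f w) +
              xi (e i) w * (K u (e i) * f w + xi (e i) w * g w).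
have aF i : all_moments P (F i) by rewrite /F; all_moments_tac.
have aG i : all_moments P (G i) by rewrite /G; all_moments_tac.
have FG i : ibp u (F i) (G i).
  by apply: (ibpM (e i) _ _ (ibpM (e i) af ag fg)); all_moments_tac.
have := ibpD (all_moments_sum (index_enum I) aF) (all_moments_sum (index_enum I) aG)
  (all_momentsM (all_moments_cst P (- c)) af) (all_momentsM (all_moments_cst P (- c)) ag)
  (ibp_sum (index_enum I) aF aG FG) (ibpZ (- c) af ag fg).
congr ibp; apply/funext => w.
  rewrite exprS mulrBl mulNr; congr (_ + _); rewrite mulr_suml; apply: eq_bigr => i _.
  by rewrite /F mulrA -expr2.
rewrite /G; under eq_bigr do rewrite mulrDr.
rewrite !big_split/=.
have -> : \sum_i xi (e i) w * (xi (e i) w * g w) = Q w * g w.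
  by rewrite mulr_suml; apply: eq_bigr => i _; rewrite mulrA -expr2.
have -> : \sum_i xi (e i) w * (K u (e i) * f w) =
    (\sum_i K u (e i) * xi (e i) w) * f w.
  by rewrite mulr_suml; apply: eq_bigr => i _; ring.
have -> : \sum_i K u (e i) * (xi (e i) w * f w) =
    (\sum_i K u (e i) * xi (e i) w) * f w.
  by rewrite mulr_suml; apply: eq_bigr => i _; ring.
rewrite /g /f /=; case: r {ih f g af ag fg F G aF aG FG} => [|r] /=.
  by rewrite expr0; ring.
by rewrite exprS !natrM -[in RHS]natr1; ring.
Qed.

(** One factor [Q - c] is opened, and each [xi_i ^+ 2] is integrated by parts as [xi_i] against
    [xi_i (Q - c)^r]. The diagonal terms add up to [c E[(Q - c)^r]], which the centring cancels. *)
Lemma expect_centered_powerS r : c = \sum_i K (e i) (e i) ->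
  \int[P]_w (Q w - c) ^+ r.+1 = (2 * r)%:R *
    \int[P]_w ((\sum_i \sum_j K (e i) (e j) * xi (e i) w * xi (e j) w) *
               (Q w - c) ^+ r.-1).
Proof.
move=> cE.
have af := all_moments_centeredX r.
have step i : \int[P]_w (xi (e i) w ^+ 2 * (Q w - c) ^+ r) =
    K (e i) (e i) * \int[P]_w ((Q w - c) ^+ r) +
    \int[P]_w ((2 * r)%:R *
      ((\sum_j K (e i) (e j) * xi (e i) w * xi (e j) w) * (Q w - c) ^+ r.-1)).
  have := ibp_centered_power (e i) r (e i) 1; rewrite mul1r.
  under eq_Rintegral do rewrite expr1 -expr2.
  move=> ->; congr (_ * _ + _); apply: eq_Rintegral => w _; rewrite ?expr0 ?mul1r//.
  have -> : \sum_j K (e i) (e j) * xi (e i) w * xi (e j) w =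
      xi (e i) w * \sum_j K (e i) (e j) * xi (e j) w.
    by rewrite mulr_sumr; apply: eq_bigr => j _; ring.
  by ring.
have aS i : all_moments P (fun w =>
  (\sum_j K (e i) (e j) * xi (e i) w * xi (e j) w) * (Q w - c) ^+ r.-1).
  by apply: all_momentsM => //; all_moments_tac.
transitivity (\int[P]_w (\sum_i xi (e i) w ^+ 2 * (Q w - c) ^+ r) -
    c * \int[P]_w (Q w - c) ^+ r).
  rewrite -mulNr -expectZ// -expectD//; [|by all_moments_tac..].
  by apply: eq_Rintegral => w _; rewrite exprS mulrBl -mulr_suml mulNr.
rewrite expect_sum => [|i]; last by all_moments_tac.
under eq_bigr do rewrite step.
rewrite big_split/= -mulr_suml -cE addrAC subrr add0r.
under eq_bigr do rewrite expectZ//.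
rewrite -mulr_sumr -expect_sum//.
by congr (_ * _); apply: eq_Rintegral => w _; rewrite mulr_suml.
Qed.

(** Schur's test: each product [x_i x_j] is bounded by half the sum of the squares, and symmetry of
    [K] turns column sums into row sums. *)
Lemma quadratic_form_le (kappa : R) w :
  (forall i, \sum_j `|K (e i) (e j)| <= kappa) ->
  \sum_i \sum_j K (e i) (e j) * xi (e i) w * xi (e j) w <= kappa * Q w.
Proof.
move=> rows; pose x i := xi (e i) w; pose k i j := `|K (e i) (e j)|.
have kC i j : k i j = k j i by rewrite /k KC.
apply: (@le_trans _ _ (\sum_i \sum_j (k i j * x i ^+ 2 + k i j * x j ^+ 2) / 2)).
  apply: ler_sum => i _; apply: ler_sum => j _.
  rewrite -mulrDr -!mulrA (le_trans (ler_norm _))// normrM ler_wpM2l//.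
  rewrite normrM -(real_normK (num_real (x i))) -(real_normK (num_real (x j))).
  by have := sqr_ge0 (`|x i| - `|x j|); rewrite -/(x i) -/(x j); lra.
have -> : \sum_i \sum_j (k i j * x i ^+ 2 + k i j * x j ^+ 2) / 2 =
    \sum_i x i ^+ 2 * \sum_j k i j.
  transitivity ((\sum_i x i ^+ 2 * \sum_j k i j + \sum_i \sum_j k i j * x j ^+ 2) / 2).
    rewrite -big_split/= mulr_suml; apply: eq_bigr => i _.
    rewrite mulr_sumr -big_split/= mulr_suml; apply: eq_bigr => j _.
    by rewrite (mulrC (k i j)).
  rewrite exchange_big/=.
  have -> : \sum_j \sum_i k i j * x j ^+ 2 = \sum_i x i ^+ 2 * \sum_j k i j.
    apply: eq_bigr => j _; rewrite mulr_sumr; apply: eq_bigr => i _.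
    by rewrite kC mulrC.
  by field.
rewrite /Q mulr_sumr; apply: ler_sum => i _.
by rewrite mulrC ler_wpM2r ?sqr_ge0//; exact: rows.
Qed.

(** Raising the exponent by two costs a factor of order [kappa^2 #|I|]: the quadratic form is at
    most [kappa Q = kappa ((Q - c) + c)], and [c] is at most [kappa #|I|] because each diagonal
    entry is bounded by its row sum. *)
Lemma expect_centered_power_le (kappa : R) s : c = \sum_i K (e i) (e i) ->
  (forall i, \sum_j `|K (e i) (e j)| <= kappa) ->
  \int[P]_w (Q w - c) ^+ (2 * s) <=
  \prod_(i < s) (8 * (2 * i + 1)%:R ^+ 2) * (kappa ^+ 2 * (#|I|%:R + 1)) ^+ s.
Proof.
move=> cE rows; elim: s => [|s ih].
  by rewrite big_ord0 expr0 mulr1; under eq_Rintegral do rewrite expr0; rewrite expect_cst.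
have K0 i : 0 <= K (e i) (e i) by apply: Rintegral_ge0 => w _; rewrite -expr2 sqr_ge0.
have Kk i : K (e i) (e i) <= kappa.
  rewrite (le_trans (ler_norm _))// (le_trans _ (rows i))//.
  by rewrite (bigD1 i)//= lerDl sumr_ge0.
have c0 : 0 <= c by rewrite cE sumr_ge0.
have ck : kappa * c <= kappa ^+ 2 * #|I|%:R.
  (* Over an empty index type [kappa] need not be nonnegative, but then [c] is an empty sum. *)
  have [I0|/card_gt0P[i _]] := posnP #|I|.
    rewrite cE big_pred0 ?mulr0 ?I0 ?mulr0// => i.
    by have := max_card (pred1 i); rewrite I0 leqn0 card1.
  have k0 : 0 <= kappa := le_trans (K0 i) (Kk i).
  rewrite expr2 -mulrA ler_wpM2l// cE mulr_natr -sumr_const ler_sum//.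
set b : R := (2 * s + 1)%:R.
have b1 : 1 <= b by rewrite /b addn1 ler1n.
set M := \int[P]_w (Q w - c) ^+ (2 * s).
have aQ r : all_moments P (fun w => (Q w - c) ^+ r) by [].
have M0 : 0 <= M by apply: Rintegral_ge0 => w _; rewrite exprM exprn_ge0 ?sqr_ge0.
have rec : \int[P]_w (Q w - c) ^+ (2 * s.+1) <= 8 * b ^+ 2 * (kappa ^+ 2 * (#|I|%:R + 1)) * M.
  set M' := \int[P]_w (Q w - c) ^+ (2 * s.+1).
  (* The odd power [(Q - c) ^+ (2 * s).+1] is absorbed by
     [2 b kappa y <= y^2 / 2 + 2 b^2 kappa^2], [y = Q - c]. *)
  have : M' <= 2^-1 * M' + (2 * b ^+ 2 * kappa ^+ 2 + 2 * b * (kappa * c)) * M.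
    rewrite {1}/M' (_ : (2 * s.+1)%N = (2 * s).+2) ?mulnS//.
    rewrite expect_centered_powerS//= -expectZ; last first.
      by apply: all_momentsM => //; all_moments_tac.
    rewrite -!expectZ// -expectD; [|by all_moments_tac..].
    apply: expect_le => [||w].
    - apply: all_momentsM; first by all_moments_tac.
      by apply: all_momentsM => //; all_moments_tac.
    - by apply: all_momentsD; apply: all_momentsM => //; all_moments_tac.
    set y := Q w - c.
    have y0 : 0 <= y ^+ (2 * s) by rewrite exprM exprn_ge0 ?sqr_ge0.
    have -> : y ^+ (2 * s.+1) = y ^+ 2 * y ^+ (2 * s) by rewrite mulnS exprD.
    rewrite !mulrA -mulrDl ler_wpM2r//.
    have := @quadratic_form_le kappa w rows; rewrite -[Q w](subrK c) -/y => h.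
    have -> : (2 * (2 * s).+1)%:R = 2 * b :> R by rewrite natrM /b addn1.
    have := sqr_ge0 (y - 2 * b * kappa).
    move: h; set q := \sum_i _ => h.
    have : b * q <= b * (kappa * (y + c)) by rewrite ler_wpM2l// (le_trans ler01).
    lra.
  move=> rec; have {rec} rec : M' <= (4 * b ^+ 2 * kappa ^+ 2 + 4 * b * (kappa * c)) * M by lra.
  apply: (le_trans rec); rewrite ler_wpM2r//.
  have h1 : 4 * b * (kappa * c) <= 4 * b * (kappa ^+ 2 * #|I|%:R).
    by apply: ler_wpM2l => //; rewrite mulr_ge0// (le_trans ler01).
  have h2 : 4 * b * (kappa ^+ 2 * #|I|%:R) <= 4 * b ^+ 2 * (kappa ^+ 2 * #|I|%:R).
    apply: ler_wpM2r; first by rewrite mulr_ge0 ?sqr_ge0.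
    by apply: ler_wpM2l => //; rewrite expr2 ler_peMl// (le_trans ler01).
  have h3 : 0 <= b ^+ 2 * (kappa ^+ 2 * #|I|%:R).
    by apply: mulr_ge0; [exact: sqr_ge0|apply: mulr_ge0 => //; exact: sqr_ge0].
  have h4 : 0 <= b ^+ 2 * kappa ^+ 2 by apply: mulr_ge0; exact: sqr_ge0.
  lra.
apply: (le_trans rec); rewrite big_ord_recr/= [_ ^+ s.+1]exprS.
rewrite [leRHS](_ : _ = 8 * b ^+ 2 * (kappa ^+ 2 * (#|I|%:R + 1)) *
  (\prod_(i < s) (8 * (2 * i + 1)%:R ^+ 2) * (kappa ^+ 2 * (#|I|%:R + 1)) ^+ s)).
  apply: ler_wpM2l => //; apply: mulr_ge0.
    by apply: mulr_ge0 => //; exact: sqr_ge0.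
  by apply: mulr_ge0; [exact: sqr_ge0|exact: addr_ge0].
rewrite -/b; move: (\prod_(i < s) _) (kappa ^+ 2 * _) => pr z; move: (z ^+ s) => zs.
by ring.
Qed.

End centered_quadratic_form.
End gaussian_integration_by_parts.

(** * Almost sure convergence *)

Lemma sum_inv_sqr_le (R : realType) N : \sum_(i < N) (i.+1%:R ^+ 2)^-1 <= 2 :> R.
Proof.
case: N => [|N]; first by rewrite big_ord0.
(* The sharper bound makes the induction go through, as [1 / (x + 1)^2 <= 1 / x - 1 / (x + 1)]. *)
suff h : \sum_(i < N.+1) (i.+1%:R ^+ 2)^-1 <= 2 - N.+1%:R^-1 :> R.
  by rewrite (le_trans h)// gerBl invr_ge0.
elim: N => [|N ih]; first by rewrite big_ord_recr big_ord0/= expr1n invr1; lra.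
rewrite big_ord_recr/= (le_trans (lerD ih (lexx _)))//.
rewrite -[N.+2%:R]natr1; set x : R := N.+1%:R.
have x0 : 0 < x by rewrite ltr0Sn.
have x1 : 0 < (x * (x + 1) ^+ 2)^-1 by rewrite invr_gt0 mulr_gt0 ?exprn_gt0//; lra.
have : 2 - (x + 1)^-1 - (2 - x^-1 + (x + 1) ^- 2) = (x * (x + 1) ^+ 2)^-1.
  by field; lra.
by move=> e; rewrite -subr_ge0 e ltW.
Qed.

(** The sum of the [f n] has a finite integral by monotone convergence, so it is finite almost
    everywhere, and the terms of a convergent series tend to 0. *)
Lemma ae_cvg0_summable (R : realType) (disp : measure_display)
    (T : measurableType disp) (mu : {measure set T -> \bar R})
    (f : nat -> T -> R) (a : nat -> R) (B : R) :
  (forall n, measurable_fun setT (f n)) -> (forall n w, 0 <= f n w) ->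
  (forall n, (\int[mu]_w (f n w)%:E <= (a n)%:E)%E) ->
  (forall N, \sum_(n < N) a n <= B) ->
  {ae mu, forall w, f n w @[n --> \oo] --> (0 : R)}.
Proof.
move=> mf f0 fa aB.
have f0E n w : (0 <= (f n w)%:E)%E by rewrite lee_fin.
have mfE n : measurable_fun setT (fun w => (f n w)%:E) by exact/measurable_EFinP.
have mS : measurable_fun setT (fun w => \sum_(n <oo) (f n w)%:E)%E.
  by apply: ge0_emeasurable_sum => //.
have iS : mu.-integrable setT (fun w => \sum_(n <oo) (f n w)%:E)%E.
  apply/integrableP; split => //.
  under eq_integral do (rewrite gee0_abs; last exact: nneseries_ge0).
  rewrite integral_nneseries//.
  apply: (@le_lt_trans _ _ B%:E); last by rewrite ltry.
  apply: lime_le.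
    by apply: is_cvg_nneseries => n _ _; exact: integral_ge0.
  apply: nearW => N; rewrite big_mkord (@le_trans _ _ (\sum_(n < N) (a n)%:E)%E)//.
    by apply: lee_sum => n _; exact: fa.
  by rewrite sumEFin lee_fin.
apply: filterS (integrable_ae measurableT iS) => w /(_ I) fin.
apply: cvg_series_cvg_0.
apply: nondecreasing_is_cvgn.
  by apply/nondecreasing_seqP => n; rewrite seriesSr lerDl.
exists (fine (\sum_(n <oo) (f n w)%:E)%E) => _ [N _ <-].
rewrite -lee_fin fineK// /series/= -sumEFin.
by apply: nneseries_lim_ge => n _ _; exact: f0E.
Qed.

(** * Finite differences and exponential sums *)

(** This is [increment] over an arbitrary additive group, so that the same formulas serve for row
    vectors and on the real line. *)
Definition diff_op (V : zmodType) (W : zmodType) (h : V) (f : V -> W) : V -> W :=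
  fun t => f (t + h) - f t.

Lemma iter_diff_op (R : pzRingType) (V : zmodType) (h : V) (f : V -> R) p t :
  iter p (diff_op h) f t =
  \sum_(i < p.+1) (-1) ^+ (p + i) * 'C(p, i)%:R * f (t + h *+ i).
Proof.
elim: p t => [|p ih] t.
  by rewrite big_ord_recr big_ord0/= ?mulr0n ?addr0 ?add0r bin0 expr0 !mul1r ?mulr0n ?addr0.
rewrite iterS /diff_op !ih.
(* Both sums are brought to the range [p.+2] for Pascal's rule. At [i = 0] the truncated [i.-1]
   would contribute a spurious 1, hence the case distinction. *)
have eS : \sum_(i < p.+1) (-1) ^+ (p + i) * 'C(p, i)%:R * f (t + h + h *+ i) =
    \sum_(i < p.+2) (if (i == 0 :> nat)%N then 0 else
      (-1) ^+ (p.+1 + i) * 'C(p, i.-1)%:R * f (t + h *+ i)).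
  rewrite [RHS]big_ord_recl/= add0r; apply: eq_bigr => i _.
  by rewrite /bump/= add1n mulrS addrA !addnS !exprS !mulN1r opprK.
rewrite eS.
have e0 : - \sum_(i < p.+1) (-1) ^+ (p + i) * 'C(p, i)%:R * f (t + h *+ i) =
    \sum_(i < p.+2) (-1) ^+ (p.+1 + i) * 'C(p, i)%:R * f (t + h *+ i).
  rewrite [RHS]big_ord_recr/= bin_small// mulr0 mul0r addr0 -sumrN.
  by apply: eq_bigr => i _; rewrite addSn exprS !mulN1r !mulNr.
rewrite e0 -big_split/=; apply: eq_bigr => -[[|i] /= _] _.
  by rewrite add0r !bin0.
by rewrite binS natrD mulrDr mulrDl addrC.
Qed.

(** A shift keeps the leading coefficient, so the difference loses at least one degree. *)
Lemma size_shift_sub (R : idomainType) (q : {poly R}) (c : R) :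
  (size (q \Po ('X + c%:P) - q)%R <= (size q).-1)%N.
Proof.
have s2 : size ('X + c%:P) = 2%N by rewrite size_XaddC.
apply/leq_sizeP => j; rewrite coefB; case: (ltngtP j (size q).-1) => // [qj|-> _].
  have qj' : (size q <= j)%N by move: qj; case: (size q).
  by rewrite !nth_default ?subr0// size_comp_poly2.
rewrite -[q`_ _]/(lead_coef q) -{1}(size_comp_poly2 q s2) -[_`_ _]/(lead_coef _).
rewrite lead_coef_comp ?s2// lead_coefDl ?size_polyX ?lead_coefX ?expr1n ?mulr1 ?subrr//.
by rewrite size_polyC; case: eqP.
Qed.

Lemma iter_diff_op_horner (R : idomainType) (h : R) (q : {poly R}) p t :
  (size q <= p)%N -> iter p (diff_op h) (horner q) t = 0.
Proof.
elim: p q t => [|p ih] q t.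
  by rewrite leqn0 size_poly_eq0 => /eqP ->; rewrite /= horner0.
move=> qp; rewrite iterSr.
have -> : diff_op h (horner q) = horner (q \Po ('X + h%:P) - q).
  by apply/funext => x; rewrite /diff_op !hornerE horner_comp !hornerE.
apply: ih; rewrite (leq_trans (size_shift_sub _ _))//.
by move: qp; case: (size q).
Qed.

Lemma sum_binomial_horner (R : idomainType) (q : {poly R}) p :
  (size q <= p)%N -> \sum_(i < p.+1) (-1) ^+ (p + i) * 'C(p, i)%:R * q.[i%:R] = 0.
Proof.
move=> qp; have := iter_diff_op_horner 1 0 qp; rewrite iter_diff_op => e.
by rewrite -[RHS]e; apply: eq_bigr => i _; rewrite add0r.
Qed.

Lemma is_derive1_sum (R : realType) n (f : 'I_n -> R -> R) (a : 'I_n -> R) (x : R) :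
  (forall i, is_derive x 1 (f i) (a i)) ->
  is_derive x 1 (fun y => \sum_(i < n) f i y) (\sum_(i < n) a i).
Proof.
move=> df; have -> : (fun y => \sum_(i < n) f i y) = \sum_(i < n) f i.
  by apply/funext => y; rewrite fct_sumE.
exact: is_derive_sum.
Qed.

(** Rolle's theorem between consecutive zeros. The base point of the path is the smallest zero of
    [f], which lets the induction order the new zeros. *)
Lemma rolle_path (R : realType) (f f' : R -> R) x s :
  (forall t, is_derive t (1 : R) f (f' t)) -> path <%R x s ->
  (forall z, z \in x :: s -> f z = 0) ->
  exists s', [/\ size s' = size s, path <%R x s' & forall z, z \in s' -> f' z = 0].
Proof.
move=> df; elim: s x => [|y s ih] x; first by exists [::].
move=> /= /andP[xy ys] fz.
have [|s' [ss' ps' fs']] := ih y ys.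
  by move=> z zs; apply: fz; rewrite inE zs orbT.
have cf : continuous f.
  by move=> t; apply/differentiable_continuous/derivable1_diffP; have [] := df t.
have [|||c] := @Rolle _ f x y xy.
- by move=> t _; have [] := df t.
- exact: continuous_subspaceT.
- by rewrite !fz// !inE eqxx ?orbT.
rewrite in_itv/= => /andP[xc cy] dc.
have fc : f' c = 0 by have /@derive_val <- := df c; have /@derive_val -> := dc.
exists (c :: s'); split; first by rewrite /= ss'.
  rewrite /= xc /=; case: s' ps' {ss' fs'} => //= z s' /andP[yz ->].
  by rewrite (lt_trans cy yz).
by move=> z; rewrite inE => /predU1P[->|/fs'].
Qed.

(* Divide by the last exponential and differentiate: Rolle leaves one term and one
   zero less. *)
Lemma exp_sum_zeros (R : realType) n (mu c : nat -> R) (s : seq R) :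
  (forall i j, (i < n)%N -> (j < n)%N -> mu i = mu j -> i = j) ->
  sorted <%R s -> size s = n ->
  (forall x, x \in s -> \sum_(i < n) c i * expR (mu i * x) = 0) ->
  forall i, (i < n)%N -> c i = 0.
Proof.
elim: n c mu s => // n ih c mu s muI.
case: s => // x s /= ps [ss] zs.
pose f t := c n + \sum_(i < n) c i * expR ((mu i - mu n) * t).
pose f' t := \sum_(i < n) c i * (mu i - mu n) * expR ((mu i - mu n) * t).
have df t : is_derive t (1 : R) f (f' t).
  have dc : is_derive t (1 : R) (cst (c n)) 0 by exact: is_derive_cst.
  have de i : is_derive t (1 : R) (fun t => c i * expR ((mu i - mu n) * t))
      (c i * (mu i - mu n) * expR ((mu i - mu n) * t)).
    have dm : is_derive t (1 : R) (fun t => (mu i - mu n) * t) ((mu i - mu n) * 1).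
      by apply: is_derive1Z; exact: is_derive_id.
    apply: is_derive_eq (is_derive1Z _ (is_derive1_comp (is_derive_expR _) dm)) _.
    by rewrite mulr1 mulrA mulrAC.
  apply: is_derive_eq (is_deriveD dc (is_derive1_sum (fun i : 'I_n => de i))) _.
  by rewrite add0r.
have fE t : f t = expR (- mu n * t) * \sum_(i < n.+1) c i * expR (mu i * t).
  rewrite big_ord_recr/= mulrDr mulrCA -expRD mulNr addNr expR0 mulr1 addrC.
  congr (_ + _); rewrite mulr_sumr; apply: eq_bigr => i _.
  by rewrite mulrCA -expRD; congr (_ * expR _); ring.
have [s' [ss' ps' zs']] : exists s', [/\ size s' = size s, path <%R x s' &
    forall z, z \in s' -> f' z = 0].
  by apply: rolle_path df ps _ => z /zs; rewrite fE => ->; rewrite mulr0.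
have c0 i : (i < n)%N -> c i = 0.
  move=> ltin.
  have muI' j k : (j < n)%N -> (k < n)%N -> mu j - mu n = mu k - mu n -> j = k.
    by move=> jn kn /addIr/muI; apply; rewrite ltnS ltnW.
  have /eqP := ih (fun i => c i * (mu i - mu n)) _ s' muI' (path_sorted ps')
    (etrans ss' ss) zs' i ltin.
  rewrite mulf_eq0 => /orP[/eqP//|]; rewrite subr_eq0 => /eqP /muI.
  by rewrite ltnSn ltnS ltnW// => /(_ isT isT) e; move: ltin; rewrite e ltnn.
move=> i; rewrite ltnS leq_eqVlt => /predU1P[->|/c0//].
have := zs x; rewrite mem_head big_ord_recr/= big1 => [|j _]; last by rewrite c0 ?mul0r.
by rewrite add0r => /(_ isT)/eqP; rewrite mulf_eq0 expR_eq0 orbF => /eqP.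
Qed.

(** * Zeros of the constants [C_{p,delta}] as functions of [delta] *)

Definition gapn (i j : nat) : nat := (i - j + (j - i))%N.

Lemma gapnE (R : realType) i j : `|i%:R - j%:R : R| = (gapn i j)%:R.
Proof.
rewrite /gapn; case: (leqP i j) => [ij|/ltnW ij].
  by rewrite distrC -natrB// ger0_norm//; congr (_%:R); lia.
by rewrite -natrB// ger0_norm//; congr (_%:R); lia.
Qed.

Definition alt_binom (R : realType) (p i j : nat) : R :=
  (-1) ^+ (i + j) * 'C(p, i)%:R * 'C(p, j)%:R.

(** The coefficient of the exponential [(m + 1)^delta] in [unit_Ccoef p delta]. Pairs at distance 0
    are left out, since 0 to the power [delta] is 0 unless [delta = 0]. *)
Definition gap_coef (R : realType) (p m : nat) : R :=
  \sum_(i < p.+1) \sum_(j < p.+1) alt_binom R p i j * (gapn i j == m.+1)%:R.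

Definition unit_Ccoef (R : realType) (p : nat) (delta : R) : R :=
  \sum_(i < p.+1) \sum_(j < p.+1) alt_binom R p i j * `|i%:R - j%:R| `^ delta.

(** The pairs are grouped by their distance. The range [n] may exceed [p] so that the constants of
    two consecutive orders can be written over the same exponentials. *)
Lemma unit_Ccoef_exp_sum (R : realType) p n (delta : R) : (p <= n)%N -> delta != 0 ->
  unit_Ccoef p delta = \sum_(m < n) gap_coef R p m * expR (ln m.+1%:R * delta).
Proof.
move=> pn d0; rewrite /gap_coef.
under [RHS]eq_bigr => m _ do rewrite mulr_suml.
rewrite exchange_big/=; apply: eq_bigr => i _.
under [RHS]eq_bigr => m _ do rewrite mulr_suml.
rewrite exchange_big/=; apply: eq_bigr => j _.
under eq_bigr => m _ do rewrite -mulrA.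
rewrite -mulr_sumr; congr (_ * _); rewrite gapnE.
case e : (gapn i j) => [|g].
  by rewrite powR0// big1// => m _; rewrite mul0r.
have gn : (g < n)%N by move: e (ltn_ord i) (ltn_ord j); rewrite /gapn; lia.
rewrite (bigD1 (Ordinal gn))//= eqxx mul1r big1 ?addr0 => [|m].
  by rewrite /powR pnatr_eq0/= mulrC.
by rewrite -val_eqE/= => mg; rewrite eqSS eq_sym (negbTE mg) mul0r.
Qed.

Lemma gap_coef_ge (R : realType) p m : (p <= m)%N -> gap_coef R p m = 0.
Proof.
move=> pm; rewrite /gap_coef big1// => i _; rewrite big1// => j _.
case: eqP => [e|_]; last by rewrite mulr0.
by move: e (ltn_ord i) (ltn_ord j); rewrite /gapn; lia.
Qed.

(** The largest distance [p + 1] occurs only for the two pairs of opposite end points, and they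
    carry the same sign, so nothing cancels. *)
Lemma gap_coef_last (R : realType) p : gap_coef R p.+1 p != 0.
Proof.
have -> : gap_coef R p.+1 p = (-1) ^+ p.+1 * \sum_(i < p.+2) \sum_(j < p.+2)
    'C(p.+1, i)%:R * 'C(p.+1, j)%:R * (gapn i j == p.+1)%:R.
  rewrite mulr_sumr; apply: eq_bigr => i _; rewrite mulr_sumr; apply: eq_bigr => j _.
  rewrite /alt_binom !mulrA; case: eqP => [e|_]; last by rewrite !mulr0.
  suff -> : (i + j)%N = p.+1 by [].
  by move: e (ltn_ord i) (ltn_ord j); rewrite /gapn; lia.
rewrite mulf_neq0 ?signr_eq0// gt_eqF//.
have t0 i j : 0 <= 'C(p.+1, i)%:R * 'C(p.+1, j)%:R * (gapn i j == p.+1)%:R :> R.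
  by rewrite !mulr_ge0.
rewrite (bigD1 ord0)//= (bigD1 ord_max)//=; apply: ltr_pwDl.
  apply: ltr_pwDl; last exact: sumr_ge0.
  by rewrite bin0 binn !mul1r /gapn sub0n add0n subn0 eqxx.
by apply: sumr_ge0 => i _; exact: sumr_ge0.
Qed.

(** For an even exponent the absolute value disappears, and [(i - j)^(2k)] expands into products of
    powers of [i] and [j]. As [2k < 2p], one of the two powers is below [p], and its alternating
    binomial sum vanishes. *)
Lemma unit_Ccoef_even (R : realType) p k : (0 < k < p)%N ->
  unit_Ccoef p (2 * k%:R) = 0 :> R.
Proof.
move=> /andP[k0 kp]; rewrite /unit_Ccoef.
have pw (x : R) : `|x| `^ (2 * k%:R) = x ^+ (2 * k).
  by rewrite -natrM powR_mulrn// -normrX ger0_norm// exprM exprn_ge0 ?sqr_ge0.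
pose v i : R := (-1) ^+ i * 'C(p, i)%:R.
have v0 n : (n < p)%N -> \sum_(i < p.+1) v i * i%:R ^+ n = 0.
  move=> np; have := @sum_binomial_horner R 'X^n p; rewrite size_polyXn => /(_ np) h.
  apply: (mulfI (x := (-1) ^+ p)); first by rewrite signr_eq0.
  rewrite mulr0 -[RHS]h mulr_sumr; apply: eq_bigr => i _.
  by rewrite hornerXn exprD /v !mulrA.
transitivity (\sum_(l < (2 * k).+1) 'C(2 * k, l)%:R * (-1) ^+ l *
    ((\sum_(i < p.+1) v i * i%:R ^+ (2 * k - l)) * (\sum_(j < p.+1) v j * j%:R ^+ l))).
  under [RHS]eq_bigr => l _ do rewrite mulr_suml mulr_sumr.
  rewrite [RHS]exchange_big/=; apply: eq_bigr => i _.
  under [RHS]eq_bigr => l _ do rewrite !mulr_sumr.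
  rewrite [RHS]exchange_big/=; apply: eq_bigr => j _.
  rewrite pw exprBn mulr_sumr; apply: eq_bigr => l _.
  by rewrite /alt_binom /v -mulr_natr exprD; ring.
rewrite big1// => l _.
have [lp|pl] := ltnP l p; first by rewrite (v0 l)// !mulr0.
by rewrite (v0 (2 * k - l)%N) ?mul0r ?mulr0//; move: (ltn_ord l); lia.
Qed.

Lemma exp_sum_lnS_zeros (R : realType) n (c : nat -> R) (s : seq R) :
  uniq s -> size s = n ->
  (forall x, x \in s -> \sum_(i < n) c i * expR (ln i.+1%:R * x) = 0) ->
  forall i, (i < n)%N -> c i = 0.
Proof.
move=> us ss zs; apply: (@exp_sum_zeros R n (fun i => ln i.+1%:R) c (sort <=%R s)).
- move=> i j _ _ /(@ln_inj R); rewrite !posrE !ltr0Sn => /(_ isT isT) /eqP.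
  by rewrite eqr_nat eqSS => /eqP.
- by rewrite lt_sorted_uniq_le sort_uniq us sort_le_sorted.
- by rewrite size_sort.
- by move=> x; rewrite mem_sort => /zs.
Qed.

Lemma uniq_even_seq (R : realType) n : uniq [seq 2 * (k.+1%:R : R) | k <- iota 0 n].
Proof.
rewrite map_inj_uniq ?iota_uniq// => i j /(mulfI _) h; apply/eqP.
by rewrite -eqSS -(eqr_nat R) h// pnatr_eq0.
Qed.

(** A zero at [delta], together with those at 2, 4, .., 2(p - 1), would give [p] zeros to a sum of
    [p] exponentials. All coefficients would vanish, against [gap_coef_last]. *)
Lemma unit_Ccoef_neq0 (R : realType) p (delta : R) : (0 < p)%N ->
  (forall m : int, delta <> 2 * m%:~R) -> unit_Ccoef p delta != 0.
Proof.
case: p => // p _ dm; apply/negP => /eqP z.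
have d0 : delta != 0 by apply/eqP; have := dm 0; rewrite mulr0.
have /eqP : gap_coef R p.+1 p = 0.
  apply: (@exp_sum_lnS_zeros R p.+1 _ (delta :: [seq 2 * (k.+1%:R : R) | k <- iota 0 p])) => //.
  - rewrite /= uniq_even_seq andbT; apply/mapP => -[k _ e].
    by apply: (dm k.+1).
  - by rewrite /= size_map size_iota.
  - move=> x; rewrite inE => /predU1P[->|/mapP[k]]; first by rewrite -unit_Ccoef_exp_sum.
    rewrite mem_iota add0n => /andP[_ kp] ->; rewrite -unit_Ccoef_exp_sum//.
    by rewrite unit_Ccoef_even.
by apply/negP; exact: gap_coef_last.
Qed.

(** With [rho] the quotient of the constants at [delta1], the function [C_p - rho C_{p+1}] is a sum
    of [p + 1] exponentials that vanishes at [delta1] and at 2, 4, .., 2(p - 1). A further zero at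
    [delta2] would kill its last coefficient, which comes from [C_{p+1}] alone and is nonzero. *)
Lemma unit_Ccoef_det_neq0 (R : realType) p (delta1 delta2 : R) : (0 < p)%N ->
  (forall m : int, delta1 <> 2 * m%:~R) -> (forall m : int, delta2 <> 2 * m%:~R) ->
  delta1 != delta2 ->
  unit_Ccoef p delta2 -
    unit_Ccoef p delta1 / unit_Ccoef p.+1 delta1 * unit_Ccoef p.+1 delta2 != 0.
Proof.
case: p => // p _ dm1 dm2 d12; set rho := _ / _.
have rho0 : rho != 0 by rewrite mulf_neq0 ?invr_eq0 ?unit_Ccoef_neq0.
have n0 (delta : R) : (forall m : int, delta <> 2 * m%:~R) -> delta != 0.
  by move=> dm; apply/eqP; have := dm 0; rewrite mulr0.
apply/negP => /eqP z.
pose c m := gap_coef R p.+1 m - rho * gap_coef R p.+2 m.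
have cE x : x != 0 -> unit_Ccoef p.+1 x - rho * unit_Ccoef p.+2 x =
    \sum_(m < p.+2) c m * expR (ln m.+1%:R * x).
  move=> x0; rewrite (@unit_Ccoef_exp_sum R p.+1 p.+2)// (@unit_Ccoef_exp_sum R p.+2 p.+2)//.
  by rewrite mulr_sumr -sumrB; apply: eq_bigr => m _; rewrite mulrBl mulrA.
have : c p.+1 = 0.
  apply: (@exp_sum_lnS_zeros R p.+2 _
    [:: delta1, delta2 & [seq 2 * (k.+1%:R : R) | k <- iota 0 p]]) => //.
  - rewrite /= uniq_even_seq andbT inE negb_or d12/=.
    by apply/andP; split; apply/mapP => -[k _ e]; [apply: (dm1 k.+1)|apply: (dm2 k.+1)].
  - by rewrite /= size_map size_iota.
  - move=> x; rewrite !inE => /or3P[/eqP->|/eqP->|/mapP[k]].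
    + by rewrite -cE ?n0// /rho divfK ?subrr ?unit_Ccoef_neq0.
    + by rewrite -cE ?n0.
    + rewrite mem_iota add0n => /andP[_ kp] ->; rewrite -cE ?mulf_neq0 ?pnatr_eq0//.
      by rewrite !unit_Ccoef_even ?mulr0 ?subrr//= ?ltnS// ltnW// ltnS ltnW.
rewrite /c gap_coef_ge// sub0r => /eqP; rewrite oppr_eq0 mulf_eq0 (negbTE rho0)/=.
by apply/negP; exact: gap_coef_last.
Qed.

(** * Polynomials restricted to a line *)

Lemma size_linear_exp (R : idomainType) (a b : R) n :
  (size ((a%:P + b *: 'X) ^+ n)%R <= n.+1)%N.
Proof.
elim: n => [|n ih]; first by rewrite expr0 size_poly1.
rewrite exprS (leq_trans (size_polyMleq _ _))//.
have s2 : (size (a%:P + b *: 'X)%R <= 2)%N.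
  rewrite (leq_trans (size_polyD _ _))// geq_max size_polyC.
  rewrite (leq_trans (leq_b1 _))//= (leq_trans (size_scale_leq _ _))// size_polyX//.
by move: s2 ih; lia.
Qed.

Lemma size_prod_linear (R : idomainType) d (a b : 'I_d -> R) (m : 'I_d -> nat) :
  (size (\prod_(l < d) ((a l)%:P + b l *: 'X) ^+ m l)%R <= (\sum_(l < d) m l).+1)%N.
Proof.
elim/big_rec2: _ => [|l n q _ ih]; first by rewrite size_poly1.
rewrite (leq_trans (size_polyMleq _ _))//.
by move: ih (size_linear_exp (a l) (b l) (m l)); lia.
Qed.

(** Along the line [t + x h] a polynomial of degree at most [k] becomes a polynomial in [x] of
    degree at most [k], which a difference of order [p > k] kills. *)
Lemma diff_annihilates (R : realType) d k p (t h : 'rV[R]_d) : (k < p)%N ->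
  annihilates k (fun i : 'I_p.+1 => (-1) ^+ (p + i) * 'C(p, i)%:R)
    (fun i : 'I_p.+1 => t + h *+ i).
Proof.
move=> kp Q Qk.
pose q : {poly R} := \sum_(m <- mpoly.msupp Q) mpoly.mcoeff m Q *:
  \prod_(l < d) ((t ord0 l)%:P + h ord0 l *: 'X) ^+ (mpoly.fun_of_multinom m l).
have qE i : mpoly.meval (fun l => (t + h *+ i) ord0 l) Q = q.[i%:R].
  rewrite mpoly.mevalE /q horner_sum; apply: eq_bigr => m _.
  rewrite hornerZ horner_prod; congr (_ * _); apply: eq_bigr => l _.
  by rewrite horner_exp !hornerE !mxE mulmxnE mulr_natr.
under eq_bigr do rewrite qE.
apply: sum_binomial_horner; rewrite (leq_trans _ kp)//.
rewrite (leq_trans (size_sum _ _ _))//; apply/bigmax_leqP_seq => m mQ _.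
rewrite (leq_trans (size_scale_leq _ _))// (leq_trans (size_prod_linear _ _ _))//.
by rewrite -mpoly.mdegE (leq_trans (mpoly.msize_mdeg_lt mQ)).
Qed.

(** * Decay of differences of powers of the Euclidean norm *)

Lemma is_derive1_translate (R : realType) (f : R -> R) (h x a : R) :
  is_derive (x + h) 1 f a -> is_derive x 1 (fun y => f (y + h)) a.
Proof.
move=> df; have ds : is_derive x (1 : R) (fun y : R => y + h) 1 by exact: is_derive_shift.
have H := @is_derive1_comp R f (fun y : R => y + h) x a 1 df ds.
by rewrite -[a]mulr1; exact: H.
Qed.

(** Mean value theorem; as the step has length at most 1, the intermediate point leaves the ball of
    radius [r] by at most 1. *)
Lemma diff_op_le (R : realType) (f f' : R -> R) (h x r M : R) :
  `|h| <= 1 -> (forall y, `|y - x| <= r + 1 -> is_derive y (1 : R) f (f' y)) ->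
  (forall y, `|y - x| <= r + 1 -> `|f' y| <= M) ->
  forall y, `|y - x| <= r -> `|diff_op h f y| <= M.
Proof.
move=> h1 df f'M y yx.
have key a b : a <= b -> b - a <= 1 -> (forall z, a <= z <= b -> `|z - x| <= r + 1) ->
    `|f b - f a| <= M.
  move=> ab ba1 zr; have [||c] := @MVT_segment _ f f' a b ab.
  - by move=> z; rewrite in_itv/= => /andP[az zb]; apply/df/zr; rewrite !ltW.
  - apply: derivable_within_continuous => z; rewrite in_itv/= => zab.
    by have [] := df z (zr z zab).
  rewrite in_itv/= => cab ->; rewrite normrM (ger0_norm (_ : 0 <= b - a)) ?subr_ge0//.
  by rewrite (le_trans _ (f'M c (zr c cab)))// ler_piMr.
have /andP[hl hr] : -1 <= h <= 1 by rewrite -ler_norml.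
have /andP[yxl yxr] : - r <= y - x <= r by rewrite -ler_norml.
rewrite /diff_op.
have [h0|h0] := leP 0 h.
  apply: key; [lra|lra|move=> z /andP[z1 z2]].
  by rewrite ler_norml; apply/andP; split; lra.
rewrite distrC; apply: key; [lra|lra|move=> z /andP[z1 z2]].
by rewrite ler_norml; apply/andP; split; lra.
Qed.

(** The steps form a list because the covariance of two increments mixes differences with steps 1
    and -1. *)
Fixpoint diff_ops (R : zmodType) (hs : seq R) (f : R -> R) : R -> R :=
  if hs is h :: hs' then diff_ops hs' (diff_op h f) else f.

Lemma diff_ops_nseq (R : zmodType) (h : R) p f : diff_ops (nseq p h) f = iter p (diff_op h) f.
Proof. by elim: p f => // p ih f; rewrite iterSr -ih. Qed.

Lemma diff_ops_cat (R : zmodType) (hs ks : seq R) f :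
  diff_ops (hs ++ ks) f = diff_ops ks (diff_ops hs f).
Proof. by elim: hs f => //= h hs ih f. Qed.

(** Here [f i] is the derivative of order [i]. Each difference is traded for one derivative and one
    unit of radius. *)
Lemma diff_ops_le (R : realType) (hs : seq R) (f : nat -> R -> R) (x M : R) :
  (forall h, h \in hs -> `|h| <= 1) ->
  (forall i y, (i < size hs)%N -> `|y - x| <= (size hs)%:R ->
    is_derive y (1 : R) (f i) (f i.+1 y)) ->
  (forall y, `|y - x| <= (size hs)%:R -> `|f (size hs) y| <= M) ->
  `|diff_ops hs (f 0%N) x| <= M.
Proof.
elim: hs f => [|h hs ih] f hs1 df fM /=.
  by apply: fM; rewrite subrr normr0.
have h1 : `|h| <= 1 by apply: hs1; rewrite mem_head.
apply: (ih (fun i => diff_op h (f i))).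
- by move=> k khs; apply: hs1; rewrite inE khs orbT.
- move=> i y ihs yx; apply: is_deriveB.
    apply: is_derive1_translate; apply: df; first by rewrite /= ltnS ltnW.
    by rewrite /= -natr1 addrAC (le_trans (ler_normD _ _))// lerD.
  apply: df; first by rewrite /= ltnS ltnW.
  by rewrite /= (le_trans yx)// ler_nat.
- apply: (@diff_op_le _ _ (f (size hs).+1)) => // y.
    by rewrite natr1; exact: df.
  by rewrite natr1; exact: fM.
Qed.

Section quadratic_power.
Context (R : realType) (s A : R).
Hypothesis A0 : 0 <= A.

(* The iterated derivatives of [q `^ s], [q = D + 2 * B * x + A * x ^+ 2]; the
   recursion is Leibniz' rule applied to [q * f' = s * q' * f]. *)
Fixpoint quad_deriv (B D : R) (j : nat) (x : R) : R :=
  let q := D + 2 * B * x + A * x ^+ 2 in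
  match j with
  | 0 => q `^ s
  | j1.+1 => match j1 with
    | 0 => s * (2 * (B + A * x)) * quad_deriv B D j1 x / q
    | j0.+1 => ((s - j1%:R) * (2 * (B + A * x)) * quad_deriv B D j1 x +
        j1%:R * (s - j0%:R / 2) * (2 * A) * quad_deriv B D j0 x) / q
    end
  end.

Lemma quad_derivSS B D j x : quad_deriv B D j.+2 x =
  ((s - j.+1%:R) * (2 * (B + A * x)) * quad_deriv B D j.+1 x +
   j.+1%:R * (s - j%:R / 2) * (2 * A) * quad_deriv B D j x) /
  (D + 2 * B * x + A * x ^+ 2).
Proof. by []. Qed.

Lemma is_derive_quad_deriv B D x j : 0 < D + 2 * B * x + A * x ^+ 2 ->
  is_derive x (1 : R) (quad_deriv B D j) (quad_deriv B D j.+1 x).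
Proof.
pose q y := D + 2 * B * y + A * y ^+ 2.
pose q' y := 2 * (B + A * y).
rewrite -/(q x) => q0.
have dX : is_derive x (1 : R) (fun y : R => y) 1 by exact: is_derive_id.
have dq' : is_derive x (1 : R) q' (2 * A).
  have dB : is_derive x (1 : R) (cst B) 0 by exact: is_derive_cst.
  apply: is_derive_eq (is_derive1Z 2 (is_deriveD dB (is_derive1Z A dX))) _.
  by rewrite add0r mulr1.
have dq : is_derive x (1 : R) q (q' x).
  have dD : is_derive x (1 : R) (cst D) 0 by exact: is_derive_cst.
  have dX2 := is_derive1M dX dX.
  apply: is_derive_eq (is_deriveD (is_deriveD dD (is_derive1Z (2 * B) dX)) (is_derive1Z A dX2)) _.
  by rewrite /q'; ring.
have qn0 : q x != 0 by rewrite gt_eqF.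
have dqV : is_derive x (1 : R) (fun y => (q y)^-1) (- q' x / q x ^+ 2).
  by apply: is_derive_eq (is_deriveV qn0 dq) _; rewrite /GRing.scale/=; field.
(* The recursion has order two, so the induction carries two consecutive derivatives. *)
suff : is_derive x (1 : R) (quad_deriv B D j) (quad_deriv B D j.+1 x) /\
  is_derive x (1 : R) (quad_deriv B D j.+1) (quad_deriv B D j.+2 x) by case.
have d0 : is_derive x (1 : R) (quad_deriv B D 0) (quad_deriv B D 1 x).
  have := is_derive1_comp (is_derive1_powR s q0) dq.
  move=> H; apply: is_derive_eq H _; rewrite /= -/(q x) -/(q' x).
  rewrite powRD ?qn0 ?implybT// powR_inv1 ?ltW//; ring.
elim: j => [|j [dj dj1]].
  split=> //.
  apply: is_derive_eq (is_derive1M (is_derive1M (is_derive1Z s dq') d0) dqV) _.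
  rewrite /= -/(q x) -/(q' x); field; exact: qn0.
split=> //.
have dj0 := is_derive1Z (j.+1%:R * (s - j%:R / 2) * (2 * A)) dj.
have dj1' := is_derive1M (is_derive1Z (s - j.+1%:R) dq') dj1.
apply: is_derive_eq (is_derive1M (is_deriveD dj1' dj0) dqV) _.
rewrite (quad_derivSS B D j.+1 x) (quad_derivSS B D j x) -/(q x) -/(q' x) fctE.
rewrite -!natr1.
move: (quad_deriv B D j.+1 x) (quad_deriv B D j x) (q x) (q' x) qn0 => f1 f0 qx q'x qx0.
field; exact: qx0.
Qed.

(** Each derivative gains a factor [q^(-1/2)]: since [A q - (B + A x)^2 = A D - B^2 >= 0], the slope
    of [q] is at most [2 sqrt(A q)]. The constant is uniform in [B], [D] and [x], that is, in the
    base point of the line. *)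
Lemma quad_deriv_le j : exists2 C, 0 <= C & forall B D x,
  0 < D + 2 * B * x + A * x ^+ 2 -> B ^+ 2 <= A * D ->
  `|quad_deriv B D j x| <= C *
    ((D + 2 * B * x + A * x ^+ 2) `^ s / Num.sqrt (D + 2 * B * x + A * x ^+ 2) ^+ j).
Proof.
suff [] : (exists2 C, 0 <= C & forall B D x,
  0 < D + 2 * B * x + A * x ^+ 2 -> B ^+ 2 <= A * D ->
  `|quad_deriv B D j x| <= C *
    ((D + 2 * B * x + A * x ^+ 2) `^ s / Num.sqrt (D + 2 * B * x + A * x ^+ 2) ^+ j)) /\
  (exists2 C, 0 <= C & forall B D x,
  0 < D + 2 * B * x + A * x ^+ 2 -> B ^+ 2 <= A * D ->
  `|quad_deriv B D j.+1 x| <= C *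
    ((D + 2 * B * x + A * x ^+ 2) `^ s / Num.sqrt (D + 2 * B * x + A * x ^+ 2) ^+ j.+1)) by [].
have slope B D x : 0 < D + 2 * B * x + A * x ^+ 2 -> B ^+ 2 <= A * D ->
    `|2 * (B + A * x)| <= 2 * Num.sqrt A * Num.sqrt (D + 2 * B * x + A * x ^+ 2).
  move=> q0 BD; rewrite normrM (ger0_norm (_ : 0 <= 2))// -mulrA ler_wpM2l//.
  rewrite -sqrtrM ?A0// -sqrtr_sqr ler_wsqrtr// -subr_ge0.
  by rewrite (_ : _ - _ = A * D - B ^+ 2) ?subr_ge0//; ring.
elim: j => [|j [[C0 C00 h0] [C1 C10 h1]]].
  split; first by exists 1 => // B D x q0 _; rewrite expr0 divr1 mul1r ger0_norm// powR_ge0.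
  exists (`|s| * (2 * Num.sqrt A)); first by rewrite !mulr_ge0// sqrtr_ge0.
  move=> B D x q0 BD; have := slope B D x q0 BD.
  rewrite /=; set q := D + _ + _; set r := Num.sqrt q => sl.
  have r0 : 0 < r by rewrite sqrtr_gt0.
  have qr : q = r ^+ 2 by rewrite sqr_sqrtr// ltW.
  rewrite !normrM normfV (ger0_norm (powR_ge0 _ _)) (gtr0_norm q0) ler_pdivrMr//.
  have -> : `|s| * (2 * Num.sqrt A) * (q `^ s / r ^+ 1) * q =
      `|s| * (2 * Num.sqrt A * r) * q `^ s.
    transitivity (`|s| * (2 * Num.sqrt A) * (q `^ s / r ^+ 1) * r ^+ 2); first by rewrite -qr.
    by field; rewrite gt_eqF.
  by rewrite ler_wpM2r ?powR_ge0// ler_wpM2l// -normrM.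
split; first by exists C1.
exists (`|s - j.+1%:R| * (2 * Num.sqrt A) * C1 + `|j.+1%:R * (s - j%:R / 2) * (2 * A)| * C0).
  by rewrite addr_ge0 ?mulr_ge0// sqrtr_ge0.
move=> B D x q0 BD; have := slope B D x q0 BD.
have := h0 B D x q0 BD; have := h1 B D x q0 BD; rewrite quad_derivSS.
set q := D + _ + _; set r := Num.sqrt q => f1 f0 sl.
have r0 : 0 < r by rewrite sqrtr_gt0.
have qr : q = r ^+ 2 by rewrite sqr_sqrtr// ltW.
rewrite normrM normfV (gtr0_norm q0) ler_pdivrMr//.
rewrite (le_trans (ler_normD _ _))// !(normrM (_ * _) (quad_deriv _ _ _ _)).
have -> : (`|s - j.+1%:R| * (2 * Num.sqrt A) * C1 + `|j.+1%:R * (s - j%:R / 2) * (2 * A)| * C0) *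
    (q `^ s / r ^+ j.+2) * q =
  (`|s - j.+1%:R| * (2 * Num.sqrt A * r)) * (C1 * (q `^ s / r ^+ j.+1)) +
  `|j.+1%:R * (s - j%:R / 2) * (2 * A)| * (C0 * (q `^ s / r ^+ j)).
  by rewrite {2}qr !exprS; field; rewrite expf_neq0 gt_eqF.
apply: lerD; last by rewrite ler_wpM2l.
apply: ler_pM => //; rewrite (normrM (s - _)); exact: ler_wpM2l.
Qed.

End quadratic_power.

Lemma sqrt_powR (R : realType) (x s : R) : 0 <= x -> Num.sqrt x `^ s = x `^ (s / 2).
Proof. by move=> x0; rewrite -powR12_sqrt// -powRrM mulrC. Qed.

(** For [D = |t|^2], [B = <t, h>], [A = |h|^2], the root of the quadratic is the norm [r] of a point
    of the line through [t], and it stays above [|t| / 2 >= 1] on the range of the steps. With [n]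
    the number of steps, the derivative of order [n] is [O(r^(delta - n))], and [n >= K + 2d] makes
    this [O((|t| / 2)^(-2d))]. *)
Lemma quad_power_diff_le (R : realType) (A delta : R) (p d K : nat) (hs : seq R) :
  0 <= A -> (forall h, h \in hs -> `|h| <= 1) -> delta <= K%:R ->
  (K + 2 * d <= size hs)%N ->
  exists2 C, 0 <= C & forall B D, B ^+ 2 <= A * D -> 2 <= Num.sqrt D ->
    2 * (size hs)%:R * Num.sqrt A <= Num.sqrt D ->
    `|diff_ops hs (fun x => (D + 2 * B * x + A * x ^+ 2) `^ (delta / 2)) 0| <=
      C * ((D / 4) ^+ d)^-1.
Proof.
move=> A0 hs1 dK Kp; have [C C0 hC] := quad_deriv_le (delta / 2) A0 (size hs).
exists C => // B D BD D2 DA.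
have D0 : 0 < D by rewrite -sqrtr_gt0; lra.
have qlow y : `|y - 0| <= (size hs)%:R ->
    Num.sqrt D / 2 <= Num.sqrt (D + 2 * B * y + A * y ^+ 2).
  rewrite subr0 => yp.
  have sD : Num.sqrt D ^+ 2 = D by rewrite sqr_sqrtr// ltW.
  have sA : Num.sqrt A ^+ 2 = A by rewrite sqr_sqrtr.
  have h0 : Num.sqrt D / 2 <= Num.sqrt D - `|y| * Num.sqrt A.
    have : `|y| * Num.sqrt A <= (size hs)%:R * Num.sqrt A by rewrite ler_wpM2r ?sqrtr_ge0.
    lra.
  rewrite (le_trans h0)// -[leLHS]ger0_norm; last by lra.
  rewrite -sqrtr_sqr ler_wsqrtr// -subr_ge0.
  have -> : D + 2 * B * y + A * y ^+ 2 - (Num.sqrt D - `|y| * Num.sqrt A) ^+ 2 =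
      2 * (B * y + Num.sqrt A * Num.sqrt D * `|y|).
    rewrite sqrrB sD exprMn sA real_normK ?num_real//; ring.
  rewrite mulr_ge0//.
  have : `|B * y| <= Num.sqrt A * Num.sqrt D * `|y|.
    rewrite normrM ler_wpM2r// -sqrtr_sqr -sqrtrM// ler_wsqrtr//.
  by rewrite ler_norml => /andP[h _]; lra.
have q0 y : `|y - 0| <= (size hs)%:R -> 0 < D + 2 * B * y + A * y ^+ 2.
  by move=> /qlow h; rewrite -sqrtr_gt0; lra.
apply: (@diff_ops_le _ hs (quad_deriv (delta / 2) A B D)) => //.
  by move=> i y _ yp; apply: is_derive_quad_deriv; exact: q0.
move=> y yp; rewrite (le_trans (hC B D y (q0 y yp) BD))// ler_wpM2l//.
have := qlow y yp; have := q0 y yp.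
set q := D + _ + _; set r := Num.sqrt q => qp rD.
have r1 : 1 <= r by lra.
have r0 : 0 < r by lra.
rewrite -(sqrt_powR _ (ltW qp)) -/r.
have -> : (D / 4) ^+ d = (Num.sqrt D / 2) ^+ (2 * d).
  by rewrite exprM; congr (_ ^+ _); rewrite expr_div_n (sqr_sqrtr (ltW D0)); field.
rewrite ler_pdivrMr ?exprn_gt0// mulrC.
rewrite ler_pdivlMr; last by rewrite exprn_gt0//; lra.
apply: (@le_trans _ _ (r ^+ K * r ^+ (2 * d))); last first.
  by rewrite -exprD ler_weXn2l.
have D20 : 0 <= Num.sqrt D / 2 by lra.
apply: ler_pM.
- exact: powR_ge0.
- exact: exprn_ge0.
- by rewrite -(powR_mulrn _ (ltW r0)) ler_powR.
- by apply: lerXn2r; rewrite ?nnegrE// (le_trans D20).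
Qed.

(** Lagrange's identity: the double sum of squares in the proof is twice the difference of the two
    sides. *)
Lemma sqr_sum_mul_le (R : realType) d (t h : 'I_d -> R) :
  (\sum_l t l * h l) ^+ 2 <= (\sum_l h l ^+ 2) * (\sum_l t l ^+ 2).
Proof.
rewrite -subr_ge0.
have : 0 <= \sum_i \sum_j (t i * h j - t j * h i) ^+ 2.
  by apply: sumr_ge0 => i _; apply: sumr_ge0 => j _; exact: sqr_ge0.
have -> : \sum_i \sum_j (t i * h j - t j * h i) ^+ 2 =
    2 * ((\sum_l h l ^+ 2) * (\sum_l t l ^+ 2) - (\sum_l t l * h l) ^+ 2).
  have e1 : (\sum_l h l ^+ 2) * (\sum_l t l ^+ 2) = \sum_i \sum_j h j ^+ 2 * t i ^+ 2.
    rewrite mulrC mulr_suml; apply: eq_bigr => i _; rewrite mulr_sumr.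
    by apply: eq_bigr => j _; rewrite mulrC.
  have e2 : (\sum_l t l * h l) ^+ 2 = \sum_i \sum_j (t i * h i) * (t j * h j).
    by rewrite expr2 mulr_suml; apply: eq_bigr => i _; rewrite mulr_sumr.
  have e3 : \sum_i \sum_j h j ^+ 2 * t i ^+ 2 = \sum_i \sum_j h i ^+ 2 * t j ^+ 2.
    by rewrite exchange_big.
  transitivity (\sum_i \sum_j h j ^+ 2 * t i ^+ 2 + \sum_i \sum_j h i ^+ 2 * t j ^+ 2 -
      2 * \sum_i \sum_j (t i * h i) * (t j * h j)); last by rewrite -e3 e1 e2; ring.
  rewrite mulr_sumr -big_split -sumrB/=; apply: eq_bigr => i _.
  rewrite mulr_sumr -big_split -sumrB/=; apply: eq_bigr => j _; ring.
by rewrite pmulr_rge0.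
Qed.

Lemma sum_sqr_line (R : realType) d (t h : 'rV[R]_d) (x : R) :
  \sum_l t ord0 l ^+ 2 + 2 * (\sum_l t ord0 l * h ord0 l) * x +
    (\sum_l h ord0 l ^+ 2) * x ^+ 2 = \sum_l (t ord0 l + x * h ord0 l) ^+ 2.
Proof.
by rewrite mulr_suml mulr_sumr mulr_suml -!big_split/=; apply: eq_bigr => l _; ring.
Qed.

Lemma sum_sqr_line_ge0 (R : realType) d (t h : 'rV[R]_d) (x : R) :
  0 <= \sum_l t ord0 l ^+ 2 + 2 * (\sum_l t ord0 l * h ord0 l) * x +
    (\sum_l h ord0 l ^+ 2) * x ^+ 2.
Proof. by rewrite sum_sqr_line; apply: sumr_ge0 => l _; exact: sqr_ge0. Qed.

Lemma enorm_line (R : realType) d (t h : 'rV[R]_d) (x : R) :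
  enorm (t + x *: h) = Num.sqrt (\sum_l t ord0 l ^+ 2 +
    2 * (\sum_l t ord0 l * h ord0 l) * x + (\sum_l h ord0 l ^+ 2) * x ^+ 2).
Proof.
rewrite /enorm sum_sqr_line; congr Num.sqrt; apply: eq_bigr => l _.
by rewrite !mxE.
Qed.

(* Up to scaling, the contribution of [enorm `^ delta] to the covariance of the
   increments of order [p] at two lattice points that differ by [t]. *)
Definition cov_diff (R : realType) d (delta : R) (p : nat) (h t : 'rV[R]_d) : R :=
  \sum_(a < p.+1) \sum_(b < p.+1)
    ((-1) ^+ (p + a) * 'C(p, a)%:R) * ((-1) ^+ (p + b) * 'C(p, b)%:R) *
    enorm (t + (a%:R - b%:R) *: h) `^ delta.

(** The index [a] comes from [p] differences with step 1 and [b] from [p] differences with step -1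
    along the line [t + x h]. *)
Lemma cov_diff_diff_ops (R : realType) d (delta : R) p (h t : 'rV[R]_d) :
  cov_diff delta p h t = diff_ops (nseq p (-1) ++ nseq p 1)
    (fun x => (\sum_l t ord0 l ^+ 2 + 2 * (\sum_l t ord0 l * h ord0 l) * x +
      (\sum_l h ord0 l ^+ 2) * x ^+ 2) `^ (delta / 2)) 0.
Proof.
have -> : (fun x => (\sum_l t ord0 l ^+ 2 + 2 * (\sum_l t ord0 l * h ord0 l) * x +
      (\sum_l h ord0 l ^+ 2) * x ^+ 2) `^ (delta / 2)) =
   (fun x => enorm (t + x *: h) `^ delta).
  by apply/funext => x; rewrite enorm_line sqrt_powR// sum_sqr_line_ge0.
rewrite diff_ops_cat !diff_ops_nseq iter_diff_op; apply: eq_bigr => a _.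
rewrite iter_diff_op mulr_sumr; apply: eq_bigr => b _.
by rewrite add0r mulNrn !mulrA.
Qed.

(** Far from the origin the decay [|t|^(-2d)] dominates the product, since each [1 + |t_l|] is at
    most [2 |t|]; near the origin both sides are compared with constants. The product form is chosen
    because its sum over a lattice factors into one-dimensional sums. *)
Lemma cov_diff_le (R : realType) d (delta : R) p K (h : 'rV[R]_d) :
  0 <= delta -> delta <= K%:R -> (K + 2 * d <= 2 * p)%N ->
  exists2 C, 0 <= C & forall t : 'rV[R]_d,
    `|cov_diff delta p h t| <= C * \prod_l ((1 + `|t ord0 l|) ^+ 2)^-1.
Proof.
move=> d0 dK Kp; pose A := \sum_l h ord0 l ^+ 2.
have A0 : 0 <= A by apply: sumr_ge0 => l _; exact: sqr_ge0.
pose hs : seq R := nseq p (-1) ++ nseq p 1.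
have shs : size hs = (2 * p)%N by rewrite size_cat !size_nseq mul2n addnn.
have hs1 k : k \in hs -> `|k| <= 1.
  by rewrite mem_cat => /orP[] /nseqP[-> _]; rewrite ?normrN normr1.
have [|C1 C10 hC1] := @quad_power_diff_le R A delta p d K hs A0 hs1 dK.
  by rewrite shs.
pose m0 := Num.max 2 (2 * (size hs)%:R * Num.sqrt A).
(* A bound for the quadratic near the origin: its values at [x] and [-x] are nonnegative with sum
   [2 D + 2 A x^2], while [D <= m0^2] and [|x| <= p]. *)
pose M := 2 * m0 ^+ 2 + 2 * p%:R ^+ 2 * A.
pose C2 := \sum_(a < p.+1) \sum_(b < p.+1)
    `|((-1) ^+ (p + a) * 'C(p, a)%:R) * ((-1) ^+ (p + b) * 'C(p, b)%:R)| *
    M `^ (delta / 2).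
have C20 : 0 <= C2.
  apply: sumr_ge0 => a _; apply: sumr_ge0 => b _; rewrite mulr_ge0// powR_ge0//.
have m02 : 2 <= m0 by rewrite le_max lexx.
exists (C1 * 16 ^+ d + C2 * ((1 + m0) ^+ 2) ^+ d).
  by rewrite addr_ge0 ?mulr_ge0 ?exprn_ge0// addr_ge0//; lra.
move=> t; pose D := \sum_l t ord0 l ^+ 2; pose B := \sum_l t ord0 l * h ord0 l.
have D0 : 0 <= D by apply: sumr_ge0 => l _; exact: sqr_ge0.
have BD : B ^+ 2 <= A * D by exact: sqr_sum_mul_le.
have tD l : `|t ord0 l| <= Num.sqrt D.
  rewrite -sqrtr_sqr ler_wsqrtr// /D (bigD1 l)//= lerDl sumr_ge0// => i _.
  exact: sqr_ge0.
set W := \prod_l _.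
have W0 : 0 <= W by apply: prodr_ge0 => l _; rewrite invr_ge0 sqr_ge0.
have Wlow b : 1 + Num.sqrt D <= b -> ((b ^+ 2) ^+ d)^-1 <= W.
  move=> Db; rewrite /W -exprVn -[d in leLHS]card_ord -prodr_const; apply: ler_prod => l _.
  have t0 : 0 < 1 + `|t ord0 l| by rewrite ltr_pwDl.
  have tb : 1 + `|t ord0 l| <= b by rewrite (le_trans _ Db)// lerD2l.
  rewrite invr_ge0 sqr_ge0/= lef_pV2 ?posrE ?exprn_gt0//; last exact: lt_le_trans tb.
  by apply: lerXn2r => //; rewrite nnegrE; [lra|exact: le_trans (ltW t0) tb].
have [mD|Dm] := leP m0 (Num.sqrt D).
  apply: (@le_trans _ _ (C1 * 16 ^+ d * W)); last first.
    by rewrite ler_wpM2r// lerDl mulr_ge0// exprn_ge0// exprn_ge0//; lra.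
  rewrite cov_diff_diff_ops (le_trans (hC1 B D BD _ _))//.
  - exact: le_trans m02 mD.
  - by rewrite (le_trans _ mD)// le_max lexx orbT.
  - rewrite -mulrA ler_wpM2l// .
    have D2 : 2 <= Num.sqrt D by exact: le_trans m02 mD.
    have e4 : (2 * Num.sqrt D) ^+ 2 = 2 ^+ 2 * D by rewrite exprMn sqr_sqrtr.
    have := Wlow (2 * Num.sqrt D); rewrite e4 => h1.
    apply: (@le_trans _ _ (16 ^+ d * (((2 ^+ 2) * D) ^+ d)^-1)); last first.
      by rewrite ler_wpM2l ?exprn_ge0// h1//; lra.
    rewrite -!exprVn -exprMn le_eqVlt; apply/orP; left; apply/eqP; congr (_ ^+ _).
    have : 0 < D by rewrite -sqrtr_gt0; lra.
    by move=> ?; field; rewrite gt_eqF.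
apply: (@le_trans _ _ (C2 * ((1 + m0) ^+ 2) ^+ d * W)); last first.
  by rewrite ler_wpM2r// lerDr mulr_ge0// exprn_ge0.
apply: (@le_trans _ _ C2); last first.
  rewrite -mulrA ler_peMr//.
  have m1 : 0 < ((1 + m0) ^+ 2) ^+ d by rewrite !exprn_gt0//; lra.
  rewrite -ler_pdivrMl// mulr1 Wlow//; lra.
rewrite /cov_diff (le_trans (ler_norm_sum _ _ _))//; apply: ler_sum => a _.
rewrite (le_trans (ler_norm_sum _ _ _))//; apply: ler_sum => b _.
rewrite normrM ler_wpM2l// ger0_norm ?powR_ge0// enorm_line -/A -/B -/D.
set q := D + _ + _.
have ab : (a%:R - b%:R) ^+ 2 <= p%:R ^+ 2 :> R.
  have := ltn_ord a; have := ltn_ord b; rewrite !ltnS => bp ap.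
  rewrite -[leLHS]real_normK ?num_real// gapnE -!natrX ler_nat leq_sqr /gapn; lia.
have q0 : 0 <= q by exact: sum_sqr_line_ge0.
have Dm2 : D <= m0 ^+ 2.
  rewrite -[leLHS]sqr_sqrtr//; apply: lerXn2r; rewrite ?nnegrE ?sqrtr_ge0// ?(ltW Dm)//; lra.
have qM : q <= M.
  have := sum_sqr_line_ge0 t h (- (a%:R - b%:R)); rewrite -/A -/B -/D sqrrN => h1.
  have h2 : A * (a%:R - b%:R) ^+ 2 <= A * p%:R ^+ 2 by rewrite ler_wpM2l.
  by rewrite /q /M; lra.
rewrite sqrt_powR// ge0_ler_powR ?nnegrE//; first by rewrite divr_ge0.
exact: le_trans q0 qM.
Qed.

(** * Lattice sums and lattice points *)

Lemma sum_inv_sqr_sym_le (R : realType) M :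
  \sum_(k < (M + M).+1) ((1 + `|(k%:R - M%:R : R)|) ^+ 2)^-1 <= 4.
Proof.
rewrite -addnS big_split_ord/=; have -> : (4 : R) = 2 + 2 by rewrite -natrD.
apply: lerD; last first.
  apply: le_trans (sum_inv_sqr_le R M.+1); rewrite le_eqVlt; apply/orP; left; apply/eqP.
  by apply: eq_bigr => k _; rewrite natrD addrAC subrr add0r normr_nat -nat1r.
apply: le_trans (sum_inv_sqr_le R M); rewrite [leRHS](reindex_inj rev_ord_inj)/=.
apply: ler_sum => k _; rewrite gapnE nat1r lef_pV2 ?posrE ?exprn_gt0//.
apply: lerXn2r; rewrite ?nnegrE// ler_nat ltnS /gapn; lia.
Qed.

Lemma sum_inj_le (R : realType) (I J : finType) (f : I -> J) (F : J -> R) :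
  injective f -> (forall j, 0 <= F j) -> \sum_i F (f i) <= \sum_j F j.
Proof.
move=> fI F0; have -> : \sum_i F (f i) = \sum_(j in f @: predT) F j.
  by rewrite big_imset//= => x y _ _; exact: fI.
by rewrite [leRHS](bigID (mem (f @: predT)))/= lerDl sumr_ge0.
Qed.

(** The differences [z0 - z i] are distinct points of an integer cube, and over the whole cube the
    sum is a [d]-th power of a one-dimensional sum. The cube may be as large as needed, as its size
    [M] does not enter the bound. *)
Lemma lattice_row_sum (R : realType) d (I : finType) (z : I -> 'rV[int]_d) (z0 : 'rV[int]_d) :
  injective z ->
  \sum_i \prod_l ((1 + `|((z0 ord0 l - z i ord0 l)%:~R : R)|) ^+ 2)^-1 <= 4 ^+ d.
Proof.
move=> zI; pose u i l : int := (z0 ord0 l - z i ord0 l)%R.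
pose M := (\sum_i \sum_l `|u i l|)%N.
have uM i l : (`|u i l| <= M)%N.
  rewrite /M (bigD1 i)//= (bigD1 l)//= -addnA; exact: leq_addr.
pose f i : {ffun 'I_d -> 'I_(M + M).+1} := [ffun l => inord `|(u i l + M%:Z)%R|%N].
have fE i l : (f i l : nat)%:Z = u i l + M%:Z.
  by rewrite ffunE inordK; have := uM i l; lia.
have fI : injective f.
  move=> i j fij; apply: zI; apply/rowP => l.
  by have := fE i l; rewrite fij fE => /addIr/addrI/oppr_inj ->.
pose w (k : 'I_(M + M).+1) : R := ((1 + `|(k%:R - M%:R : R)|) ^+ 2)^-1.
have w0 k : 0 <= w k by rewrite invr_ge0 sqr_ge0.
rewrite (eq_bigr (fun i => \prod_l w (f i l))); last first.
  move=> i _; apply: eq_bigr => l _; rewrite /w; congr ((1 + `|_|) ^+ 2)^-1.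
  rewrite -/(u i l); have -> : ((f i l : nat)%:R : R) = (u i l)%:~R + M%:R.
    by rewrite -[LHS]/(((f i l : nat)%:Z)%:~R) fE intrD.
  by rewrite addrK.
apply: le_trans (sum_inj_le (F := fun g : {ffun 'I_d -> 'I_(M + M).+1} => \prod_l w (g l)) fI _) _.
  by move=> g; apply: prodr_ge0.
rewrite -(bigA_distr_bigA (fun (_ : 'I_d) k => w k))/= prodr_const card_ord.
apply: lerXn2r; rewrite ?nnegrE ?sumr_ge0//.
exact: sum_inv_sqr_sym_le.
Qed.

Lemma coord_le_norm (R : realType) d (x : 'rV[R]_d) l : `|x ord0 l| <= `|x|.
Proof.
case: d x l => [x []//|d] x l.
by rewrite [leRHS]mx_normrE; apply: le_trans (le_bigmax _ _ (ord0, l)).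
Qed.

Lemma finite_lattice_points (R : realType) d (Omega : set 'rV[R]_d) n :
  bounded_set Omega -> (0 < n)%N -> finite_set (lattice_points Omega n).
Proof.
move=> [M0 [_ hM]] n0; have {}hM x : Omega x -> `|x| <= M0 + 1.
  by apply: hM; rewrite ltrDl.
pose M := (Num.truncn (n%:R * `|M0 + 1|)).+1.
pose f (g : {ffun 'I_d -> 'I_(M + M).+1}) : 'rV[R]_d :=
  n%:R^-1 *: \row_l ((g l)%:R - M%:R).
apply: (sub_finite_set (B := range f)).
  move=> x [Ox [z xz]].
  have nz : (n%:R : R) != 0 by rewrite pnatr_eq0 -lt0n.
  have zM l : (`|z ord0 l| <= M)%N.
    have zE : (z ord0 l)%:~R = n%:R * x ord0 l by rewrite xz !mxE mulVKf.
    have : `|(z ord0 l)%:~R : R| <= n%:R * `|M0 + 1|.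
      rewrite zE normrM normr_nat ler_wpM2l// (le_trans (coord_le_norm _ _))//.
      by rewrite (le_trans (hM x Ox))// ler_norm.
    move=> h; have := le_lt_trans h (truncnS_gt (n%:R * `|M0 + 1|)).
    rewrite -/M -intr_norm -[M%:R]/((M%:Z)%:~R) ltr_int; lia.
  exists [ffun l => inord `|(z ord0 l + M%:Z)%R|%N] => //.
  rewrite xz /f; congr (_ *: _); apply/rowP => l; rewrite !mxE ffunE inordK; last first.
    by have := zM l; lia.
  have e : ((`|(z ord0 l + M%:Z)%R|%N)%:Z = z ord0 l + M%:Z)%R by have := zM l; lia.
  have -> : (`|(z ord0 l + M%:Z)%R|%N)%:R = (z ord0 l)%:~R + M%:R :> R.
    by rewrite -[LHS]/(((`|(z ord0 l + M%:Z)%R|%N)%:Z)%:~R) e intrD.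
  by rewrite addrK.
exact/finite_image/finite_finset.
Qed.

(** [Omega] contains a sup-norm ball, that is, a cube, of radius [e] about some [x0]. The [K^d]
    lattice points reached from the rounded-down corner of [x0] lie in it when [K] is about
    [n e / 2], and [K >= n e / 4] as soon as [n e >= 4]. *)
Lemma card_lattice_points_ge (R : realType) d (Omega : set 'rV[R]_d) :
  Omega !=set0 -> bounded_set Omega -> open Omega ->
  exists2 c : R, 0 < c & \forall n \near \oo,
    c * n%:R ^+ d <= (set_size (lattice_points Omega n))%:R.
Proof.
move=> [x0 Ox0] bO oO.
have /nbhs_ballP[e /= e0 eO] : nbhs x0 Omega by exact: open_nbhs_nbhs.
exists ((e / 4) ^+ d); first by rewrite exprn_gt0// divr_gt0.
near=> n.
have n1 : (0 < n)%N by near: n; exact: nbhs_infty_gt.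
have nR : 0 < (n%:R : R) by rewrite ltr0n.
have ne : 4 / e <= n%:R by near: n; exact: nbhs_infty_ger.
rewrite ler_pdivrMr// in ne.
pose K := Num.truncn (n%:R * e / 2).
have KR : K%:R <= n%:R * e / 2 by rewrite truncn_le// mulr_ge0// mulr_ge0 ?ltW.
have RK : n%:R * e / 2 < K.+1%:R by exact: truncnS_gt.
have K4 : e / 4 * n%:R <= K%:R by move: RK; rewrite -[K.+1%:R]natr1; lra.
rewrite -exprMn.
apply: (@le_trans _ _ ((K%:R : R) ^+ d)).
  by apply: lerXn2r; rewrite ?nnegrE// mulr_ge0 ?divr_ge0 ?ltW.
rewrite -natrX ler_nat.
pose f (g : {ffun 'I_d -> 'I_K}) : 'rV[R]_d :=
  n%:R^-1 *: map_mx intr (\row_l (Num.floor (n%:R * x0 ord0 l) + (g l)%:Z)).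
have fA g : lattice_points Omega n (f g).
  split; last by eexists.
  apply: eO; split=> // i l; rewrite ord1 /f !mxE /ball/= intrD.
  set u := n%:R * x0 ord0 l.
  have := floor_itv u; rewrite intrD => /andP[u1 u2].
  have gK : ((g l)%:~R : R) + 1 <= K%:R by rewrite natr1 ler_nat.
  have g0 : 0 <= ((g l)%:~R : R) by rewrite ler0n.
  have -> : x0 ord0 l = n%:R^-1 * u by rewrite /u mulKf// gt_eqF.
  rewrite -mulrBr normrM gtr0_norm ?invr_gt0// mulrC ltr_pdivrMr//.
  rewrite ltr_norml; apply/andP; split; lra.
have fI : injective f.
  move=> g1 g2 /(scalerI (invr_neq0 (lt0r_neq0 nR))) /rowP f12; apply/ffunP => l.
  have := f12 l; rewrite !mxE => /intr_inj /addrI [] h; exact: val_inj.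
have finA := finite_lattice_points bO n1.
rewrite /set_size -(card_ord K) -[d in leqLHS]card_ord -card_ffun.
rewrite cardE -(size_map f); apply: uniq_leq_size.
  by rewrite map_inj_uniq// enum_uniq.
by move=> _ /mapP[g _ ->]; rewrite in_fset_set// inE.
Unshelve. all: by end_near. Qed.

(** * Quadratic variation of a Gaussian field *)

Section gaussian_field_moments.
Context (R : realType) (d : nat) (disp : measure_display).
Context (T : measurableType disp) (P : probability T R).
Variable Y : 'rV[R]_d -> {RV P >-> R}.
Hypothesis Y_gaussian : gaussian_field Y.
Hypothesis Y_mean : mean_zero Y.

Lemma lincomb_finType (J : finType) (a : J -> R) (s : J -> 'rV[R]_d) :
  (fun w => \sum_j a j * Y (s j) w) =
  lincomb Y (fun i : 'I_#|J| => a (enum_val i)) (fun i => s (enum_val i)).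
Proof.
apply/funext => w; rewrite /lincomb.
by rewrite (reindex (@enum_val J J))//; apply: onW_bij; exact: enum_val_bij.
Qed.

Lemma integrable_field t : P.-integrable setT (EFin \o Y t).
Proof.
have : gaussian P (Y t).
  have := Y_gaussian (fun=> 1) (fun _ : 'I_1 => t).
  by congr gaussian; apply/funext => w; rewrite /lincomb big_ord1 mul1r.
move=> /gaussian_moments[m [s [/(_ 1%N) int1 _]]].
have icst : P.-integrable setT (EFin \o cst m) by exact: finite_measure_integrable_cst.
have := integrableD measurableT int1 icst; apply: eq_integrable => // w _ /=.
by rewrite expr1 -EFinD subrK.
Qed.

Lemma field_comb_moments (J : finType) (a : J -> R) (s : J -> 'rV[R]_d) :
  let X w := \sum_j a j * Y (s j) w in
  all_moments P X /\ \int[P]_w X w = 0 /\ forall n, \int[P]_w (X w ^+ n.+1) =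
    n%:R * \int[P]_w (X w ^+ 2) * \int[P]_w (X w ^+ n.-1).
Proof.
move=> X.
have mX : measurable_fun setT X.
  by apply: measurable_sum => j; exact: measurable_funM.
pose X' : {RV P >-> R} := HB.pack X (isMeasurableFun.Build _ _ _ _ X mX).
have gX : gaussian P X'.
  have := Y_gaussian (fun i : 'I_#|J| => a (enum_val i)) (fun i => s (enum_val i)).
  by rewrite -lincomb_finType.
have EX : \int[P]_w X w = 0.
  have iX j : P.-integrable setT (EFin \o (fun w => a j * Y (s j) w)).
    by have := integrableZl measurableT (a j) (integrable_field (s j)).
  rewrite /Rintegral /X.
  under eq_integral do rewrite -sumEFin.
  rewrite integral_sum// big1// => j _.
  under eq_integral do rewrite EFinM.
  rewrite integralZl//; last exact: integrable_field.
  by have := Y_mean (s j); rewrite unlock => ->; rewrite mule0.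
have [iX rec] := centered_gaussian_moments gX EX.
by split; [split|split].
Qed.

(** The abstract estimate is applied on the space of coefficient vectors over [I], with [xi v] the
    combination of the [X i] and [e] the standard basis. Every [xi v] is again a finite combination
    of values of the field, hence centred Gaussian. *)
Lemma quad_field_moment_le (I : finType) m (a : I -> 'I_m -> R)
    (s : I -> 'I_m -> 'rV[R]_d) (X := fun i w => \sum_(b < m) a i b * Y (s i b) w)
    (kappa : R) r :
  (forall i, \sum_j `|\int[P]_w (X i w * X j w)| <= kappa) ->
  \int[P]_w (\sum_i X i w ^+ 2 - \sum_i \int[P]_w (X i w * X i w)) ^+ (2 * r) <=
  \prod_(i < r) (8 * (2 * i + 1)%:R ^+ 2) * (kappa ^+ 2 * (#|I|%:R + 1)) ^+ r.
Proof.
move=> rows.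
pose xi (v : {ffun I -> R^o}) (w : T) : R := \sum_i v i * X i w.
have xi_linear t u v w : xi (t *: u + v) w = t * xi u w + xi v w.
  rewrite /xi mulr_sumr -big_split/=; apply: eq_bigr => i _.
  by rewrite !ffunE mulrDl mulrA.
have xiE v : xi v = fun w => \sum_(ib : I * 'I_m) (v ib.1 * a ib.1 ib.2) * Y (s ib.1 ib.2) w.
  apply/funext => w; rewrite -(pair_bigA _ (fun i b => v i * a i b * Y (s i b) w))/=.
  by apply: eq_bigr => i _; rewrite /X mulr_sumr; apply: eq_bigr => b _; rewrite mulrA.
pose e i : {ffun I -> R^o} := [ffun j => (j == i)%:R].
have xie i : xi (e i) = X i.
  apply/funext => w; rewrite /xi (bigD1 i)//= ffunE eqxx mul1r big1 ?addr0// => j ji.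
  by rewrite ffunE (negbTE ji) mul0r.
have am v : all_moments P (xi v).
  by rewrite xiE; have [] := field_comb_moments
    (fun ib : I * 'I_m => v ib.1 * a ib.1 ib.2) (fun ib => s ib.1 ib.2).
have rec v n : \int[P]_w (xi v w ^+ n.+1) =
    n%:R * \int[P]_w (xi v w ^+ 2) * \int[P]_w (xi v w ^+ n.-1).
  by rewrite xiE; have [_ [_]] := field_comb_moments
    (fun ib : I * 'I_m => v ib.1 * a ib.1 ib.2) (fun ib => s ib.1 ib.2); apply.
have eE i j : \int[P]_w (xi (e i) w * xi (e j) w) = \int[P]_w (X i w * X j w).
  by rewrite !xie.
have cE : \sum_i \int[P]_w (X i w * X i w) = \sum_i \int[P]_w (xi (e i) w * xi (e i) w).
  by apply: eq_bigr => i _; rewrite eE.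
have rows' i : \sum_j `|\int[P]_w (xi (e i) w * xi (e j) w)| <= kappa.
  by rewrite (eq_bigr _ (fun j _ => congr1 Num.norm (eE i j))).
have := @expect_centered_power_le R _ T P _ xi xi_linear am rec I e _ kappa r cE rows'.
apply: le_trans; rewrite le_eqVlt; apply/orP; left; apply/eqP.
apply: eq_Rintegral => w _; congr ((_ - _) ^+ _).
by apply: eq_bigr => i _; rewrite xie.
Qed.

Lemma all_moments_quad_field (I : finType) m (a : I -> 'I_m -> R)
    (s : I -> 'I_m -> 'rV[R]_d) (c : R) :
  all_moments P (fun w => \sum_i (\sum_(b < m) a i b * Y (s i b) w) ^+ 2 + c).
Proof.
apply: all_momentsD; last exact: all_moments_cst.
apply: all_moments_sum => i; apply: all_momentsX.
by have [] := field_comb_moments (a i) (s i).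
Qed.

Lemma expect_mul_lincomb k (G : 'rV[R]_d -> R) m (a b : 'I_m -> R)
    (s t : 'I_m -> 'rV[R]_d) :
  generalized_autocov k Y G -> annihilates k a s -> annihilates k b t ->
  \int[P]_w ((\sum_i a i * Y (s i) w) * (\sum_i b i * Y (t i) w)) =
  \sum_i \sum_j a i * b j * G (s i - t j).
Proof.
move=> cov ha hb; have := cov m m a s b t ha hb.
have E0 (c : 'I_m -> R) (u : 'I_m -> 'rV[R]_d) : fine 'E_P[lincomb Y c u] = 0.
  by rewrite unlock; have [_ [h _]] := field_comb_moments c u; exact: h.
rewrite covariance.unlock !E0 unlock => h.
apply: EFin_inj; rewrite -h /Rintegral fineK.
  apply: eq_integral => w _; congr EFin.
  by rewrite -[RHS]/((lincomb Y a s w - 0) * (lincomb Y b t w - 0)) !subr0.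
have [aX _] := field_comb_moments a s; have [aZ _] := field_comb_moments b t.
by apply: integrable_fin_num => //; apply: all_moments_integrable; exact: all_momentsM.
Qed.

End gaussian_field_moments.

Lemma enorm_scale (R : realType) d (c : R) (u : 'rV[R]_d) :
  enorm (c *: u) = `|c| * enorm u.
Proof.
rewrite /enorm -sqrtr_sqr -sqrtrM ?sqr_ge0// mulr_sumr; congr Num.sqrt.
by apply: eq_bigr => l _; rewrite mxE exprMn.
Qed.

Lemma annihilates_scale (R : realType) d k m (c : R) (a : 'I_m -> R) (s : 'I_m -> 'rV[R]_d) :
  annihilates k a s -> annihilates k (fun i => c * a i) s.
Proof.
move=> ha Q hQ; under eq_bigr do rewrite -mulrA.
by rewrite -mulr_sumr ha// mulr0.
Qed.

Lemma cov_diff0 (R : realType) d (delta : R) p (h : 'rV[R]_d) :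
  cov_diff delta p h 0 = Ccoef h p delta.
Proof.
rewrite /cov_diff /Ccoef mulr_sumr; apply: eq_bigr => a _.
rewrite mulr_sumr; apply: eq_bigr => b _; rewrite add0r.
rewrite enorm_scale powRM ?sqrtr_ge0//.
have -> : (-1) ^+ (a + b) = (-1) ^+ (p + a) * (-1) ^+ (p + b) :> R.
  by rewrite -[RHS]exprD addnACA [RHS]exprD addnn -mul2n [X in _ = X * _]exprM sqrrN !expr1n mul1r.
by ring.
Qed.

Lemma lattice_point_coord (R : realType) d (Omega : set 'rV[R]_d) n (x : 'rV[R]_d) :
  (0 < n)%N -> lattice_points Omega n x ->
  x = n%:R^-1 *: map_mx intr (\row_l Num.floor (n%:R * x ord0 l)).
Proof.
move=> n0 [_ [z ->]]; congr (_ *: _); apply/rowP => l; rewrite !mxE.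
by rewrite mulVKf ?pnatr_eq0 -?lt0n// intrKfloor.
Qed.

(** The normalization [n^delta1] enters each square as [n^(delta1 / 2)], so that [Q_n^p] becomes a
    mean of squares of linear combinations of the field. *)
Lemma quad_var_finType (R : realType) d (T : Type) (Y : 'rV[R]_d -> T -> R)
    (Omega : set 'rV[R]_d) h delta1 p n w : finite_set (lattice_points Omega n) ->
  quad_var Y Omega h delta1 p n w = (set_size (lattice_points Omega n))%:R^-1 *
    \sum_(i : fset_set (lattice_points Omega n))
      (\sum_(b < p.+1) n%:R `^ (delta1 / 2) * ((-1) ^+ (p + b) * 'C(p, b)%:R) *
        Y (val i + (n%:R^-1 *: h) *+ b) w) ^+ 2.
Proof.
move=> finA; rewrite /quad_var; congr (_ * _).
rewrite fsbig_finite//= big_seq_fsetE/=; apply: eq_bigr => i _.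
have -> : iter p (increment (n%:R^-1 *: h)) (fun t => Y t w) (val i) =
   \sum_(b < p.+1) (-1) ^+ (p + b) * 'C(p, b)%:R * Y (val i + (n%:R^-1 *: h) *+ b) w.
  exact: (iter_diff_op (n%:R^-1 *: h) (fun t => Y t w) p (val i)).
have -> : \sum_(b < p.+1) n%:R `^ (delta1 / 2) * ((-1) ^+ (p + b) * 'C(p, b)%:R) *
        Y (val i + (n%:R^-1 *: h) *+ b) w = n%:R `^ (delta1 / 2) *
   \sum_(b < p.+1) (-1) ^+ (p + b) * 'C(p, b)%:R * Y (val i + (n%:R^-1 *: h) *+ b) w.
  by rewrite mulr_sumr; apply: eq_bigr => b _; rewrite !mulrA.
rewrite exprMn; congr (_ * _).
by rewrite -powR_mulrn ?powR_ge0// -powRrM divfK.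
Qed.

Lemma powR_div_nat (R : realType) (n : nat) (a b : R) : (0 < n)%N ->
  n%:R `^ a * (n%:R^-1) `^ b = n%:R `^ (a - b) :> R.
Proof.
move=> n0; have nR : (n%:R : R) != 0 by rewrite pnatr_eq0 -lt0n.
by rewrite -powR_inv1// -powRrM mulN1r powRD ?nR ?implybT.
Qed.

Section quadratic_variation.
Context (R : realType) (d : nat) (disp : measure_display).
Context (T : measurableType disp) (P : probability T R).
Variables (Y : 'rV[R]_d -> {RV P >-> R}) (Omega : set 'rV[R]_d) (h : 'rV[R]_d).
Variables (delta1 delta2 c1 c2 : R) (k : nat).
Hypothesis Y_gaussian : gaussian_field Y.
Hypothesis Y_mean : mean_zero Y.
Hypothesis delta1_gt0 : 0 < delta1.
Hypothesis delta12 : delta1 < delta2.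
Hypothesis Y_cov : generalized_autocov k Y
  (fun t => c1 * enorm t `^ delta1 + c2 * enorm t `^ delta2).
Hypothesis Omega_bounded : bounded_set Omega.

Let gamma := delta2 - delta1.

Definition mean_quad_var p n : R :=
  c1 * Ccoef h p delta1 + c2 * n%:R `^ (- gamma) * Ccoef h p delta2.

(** Homogeneity: all differences of sampling points are [1 / n] times a vector independent of the
    scale, so [|.|^delta] contributes [n^(- delta)]. The normalization [n^delta1] cancels this for
    [delta1] and leaves [n^(- gamma)] for [delta2]. *)
Lemma expect_mul_increments p n (t u : 'rV[R]_d) (z : 'rV[int]_d) :
  (k < p)%N -> (0 < n)%N -> t - u = n%:R^-1 *: map_mx intr z ->
  \int[P]_w ((\sum_(b < p.+1) n%:R `^ (delta1 / 2) * ((-1) ^+ (p + b) * 'C(p, b)%:R) *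
                Y (t + (n%:R^-1 *: h) *+ b) w) *
             (\sum_(b < p.+1) n%:R `^ (delta1 / 2) * ((-1) ^+ (p + b) * 'C(p, b)%:R) *
                Y (u + (n%:R^-1 *: h) *+ b) w)) =
  c1 * cov_diff delta1 p h (map_mx intr z) +
  c2 * n%:R `^ (- gamma) * cov_diff delta2 p h (map_mx intr z).
Proof.
move=> kp n0 tu.
have ann x := annihilates_scale (n%:R `^ (delta1 / 2))
  (diff_annihilates x (n%:R^-1 *: h) kp).
rewrite (expect_mul_lincomb Y_gaussian Y_mean Y_cov (ann t) (ann u)).
rewrite /cov_diff !mulr_sumr -big_split/=; apply: eq_bigr => a _.
rewrite !mulr_sumr -big_split/=; apply: eq_bigr => b _.
have -> : t + (n%:R^-1 *: h) *+ a - (u + (n%:R^-1 *: h) *+ b) =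
    n%:R^-1 *: (map_mx intr z + (a%:R - b%:R) *: h).
  rewrite scalerDr -tu scalerA [_ * (_ - _)]mulrC -scalerA scalerBl !scaler_nat.
  by rewrite opprD addrACA.
set v := map_mx _ _ + _.
have n1 : 0 <= (n%:R : R)^-1 by rewrite invr_ge0.
rewrite enorm_scale (ger0_norm n1) !powRM ?sqrtr_ge0//.
have e1 : n%:R `^ (delta1 / 2) * n%:R `^ (delta1 / 2) * (n%:R^-1) `^ delta1 = 1 :> R.
  by rewrite -expr2 -powR_mulrn ?powR_ge0// -powRrM divfK// powR_div_nat// subrr powRr0.
have e2 : n%:R `^ (delta1 / 2) * n%:R `^ (delta1 / 2) * (n%:R^-1) `^ delta2 =
    n%:R `^ (- gamma) :> R.
  by rewrite -expr2 -powR_mulrn ?powR_ge0// -powRrM divfK// powR_div_nat// opprB.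
rewrite -e2; set x := n%:R `^ (delta1 / 2) in e1 e2 *.
set y1 := _ `^ delta1 in e1 *.
transitivity ((x * x * y1) * c1 * ((-1) ^+ (p + a) * 'C(p, a)%:R) * ((-1) ^+ (p + b) * 'C(p, b)%:R) *
   enorm v `^ delta1 + x * x * (n%:R^-1) `^ delta2 * c2 * ((-1) ^+ (p + a) * 'C(p, a)%:R) *
   ((-1) ^+ (p + b) * 'C(p, b)%:R) * enorm v `^ delta2); first by ring.
by rewrite e1; ring.
Qed.

(** One [kappa] serves all [n], because [n^(- gamma) <= 1] and the lattice sums are uniformly
    bounded. The diagonal of the covariance matrix is constant, equal to [mean_quad_var p n].
    Dividing the moment bound [O(N^r)] by [N^(2r)] leaves [N^(-r)], with [N + 1 <= 2 N] used on the
    way. *)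
Lemma quad_var_moments p K : (k < p)%N -> delta2 <= K%:R -> (K + 2 * d <= 2 * p)%N ->
  exists kappa : R, forall n, (0 < n)%N -> (0 < set_size (lattice_points Omega n))%N ->
    all_moments P (fun w => quad_var Y Omega h delta1 p n w - mean_quad_var p n) /\
    forall r, \int[P]_w (quad_var Y Omega h delta1 p n w - mean_quad_var p n) ^+ (2 * r) <=
      \prod_(i < r) (8 * (2 * i + 1)%:R ^+ 2) * (2 * kappa ^+ 2) ^+ r *
      ((set_size (lattice_points Omega n))%:R ^+ r)^-1.
Proof.
move=> kp dK Kp.
have [||C1 C10 hC1] := @cov_diff_le R d delta1 p K h _ _ Kp.
- exact: ltW.
- by rewrite (le_trans _ dK)// ltW.
have [||C2 C20 hC2] := @cov_diff_le R d delta2 p K h _ _ Kp => //.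
  by rewrite ltW// (lt_trans delta1_gt0).
pose kappa := (`|c1| * C1 + `|c2| * C2) * 4 ^+ d; exists kappa => n n0 N0.
have finA := finite_lattice_points Omega_bounded n0.
pose I : finType := fset_set (lattice_points Omega n).
set N := set_size _ in N0 *.
have cI : #|I| = N by rewrite /N /set_size cardfE.
pose z (i : I) : 'rV[int]_d := \row_l Num.floor (n%:R * val i ord0 l).
have zE (i : I) : val i = n%:R^-1 *: map_mx intr (z i).
  apply: (lattice_point_coord n0 (Omega := Omega)).
  by have := valP i; rewrite in_fset_set// inE.
have zI : injective z by move=> i j zij; apply: val_inj; rewrite !zE zij.
pose a (i : I) (b : 'I_p.+1) : R := n%:R `^ (delta1 / 2) * ((-1) ^+ (p + b) * 'C(p, b)%:R).
pose s (i : I) (b : 'I_p.+1) : 'rV[R]_d := val i + (n%:R^-1 *: h) *+ b.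
pose X i w := \sum_(b < p.+1) a i b * Y (s i b) w.
have cov i j : \int[P]_w (X i w * X j w) =
    c1 * cov_diff delta1 p h (map_mx intr (z i - z j)) +
    c2 * n%:R `^ (- gamma) * cov_diff delta2 p h (map_mx intr (z i - z j)).
  apply: expect_mul_increments => //.
  by rewrite !zE map_mxB scalerBr.
have ng : 0 <= (n%:R `^ (- gamma) : R) <= 1.
  rewrite powR_ge0/= powRN invf_le1 ?powR_gt0 ?ltr0n//.
  by rewrite -[leLHS](powRr0 (n%:R : R)) ler_powR ?ler1n// subr_ge0 ltW.
have rows i : \sum_j `|\int[P]_w (X i w * X j w)| <= kappa.
  apply: (@le_trans _ _ ((`|c1| * C1 + `|c2| * C2) *
      \sum_j \prod_l ((1 + `|((z i ord0 l - z j ord0 l)%:~R : R)|) ^+ 2)^-1)); last first.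
    by rewrite ler_wpM2l ?addr_ge0 ?mulr_ge0// lattice_row_sum.
  rewrite mulr_sumr; apply: ler_sum => j _; rewrite cov.
  rewrite (le_trans (ler_normD _ _))// mulrDl; set W := \prod_l _.
  have WE : \prod_l ((1 + `|(map_mx intr (z i - z j) : 'rV[R]_d) ord0 l|) ^+ 2)^-1 = W.
    by apply: eq_bigr => l _; rewrite !mxE.
  have := hC1 (map_mx intr (z i - z j)); have := hC2 (map_mx intr (z i - z j)).
  rewrite WE => h2 h1; apply: lerD; rewrite !normrM -!mulrA ler_wpM2l//.
  case/andP: ng => ng0 ng1; rewrite (ger0_norm ng0) (le_trans _ h2)//.
  by rewrite ler_piMl.
have diag : \sum_i \int[P]_w (X i w * X i w) = N%:R * mean_quad_var p n.
  rewrite (eq_bigr (fun=> mean_quad_var p n)); last first.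
    move=> i _; rewrite cov subrr; have -> : map_mx intr 0 = 0 :> 'rV[R]_d.
      by apply/rowP => l; rewrite !mxE.
    by rewrite !cov_diff0.
  by rewrite sumr_const cI mulr_natl.
have Nn0 : (N%:R : R) != 0 by rewrite pnatr_eq0 -lt0n.
have qE w : quad_var Y Omega h delta1 p n w - mean_quad_var p n =
    N%:R^-1 * (\sum_i X i w ^+ 2 - \sum_i \int[P]_w (X i w * X i w)).
  by rewrite diag mulrBr mulKf// quad_var_finType.
have am : all_moments P (fun w => \sum_i X i w ^+ 2 - \sum_i \int[P]_w (X i w * X i w)).
  exact: all_moments_quad_field.
split.
  have -> : (fun w => quad_var Y Omega h delta1 p n w - mean_quad_var p n) =
    (fun w => N%:R^-1 * (\sum_i X i w ^+ 2 - \sum_i \int[P]_w (X i w * X i w))).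
    exact/funext.
  by apply: all_momentsM => //; exact: all_moments_cst.
move=> r.
have := @quad_field_moment_le R d disp T P Y Y_gaussian Y_mean I p.+1 a s kappa r rows.
rewrite -/X cI => H.
under eq_Rintegral do rewrite qE exprMn.
rewrite expectZ; last exact: all_momentsX.
have NR : 0 < (N%:R : R) by rewrite ltr0n.
apply: (le_trans (ler_wpM2l _ H)); first by rewrite exprn_ge0// invr_ge0 ltW.
set A := \prod_(i < r) _.
have A0 : 0 <= A by apply: prodr_ge0 => i _; rewrite mulr_ge0// sqr_ge0.
have N1 : 1 <= (N%:R : R) by rewrite ler1n.
have : (kappa ^+ 2 * (N%:R + 1)) ^+ r <= (2 * kappa ^+ 2) ^+ r * N%:R ^+ r.
  have k0 := sqr_ge0 kappa.
  rewrite -exprMn; apply: lerXn2r; rewrite ?nnegrE.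
  - by rewrite mulr_ge0// addr_ge0// ltW.
  - by apply: mulr_ge0; [apply: mulr_ge0|apply: ltW].
  - have : kappa ^+ 2 * (N%:R + 1) <= kappa ^+ 2 * (2 * N%:R) by rewrite ler_wpM2l//; lra.
    lra.
move=> /(ler_wpM2l A0)/(ler_wpM2l (exprn_ge0 (2 * r) (ltW (_ : 0 < N%:R^-1)))).
rewrite invr_gt0 => /(_ NR) /le_trans; apply.
rewrite exprVn mulnC exprM le_eqVlt; apply/orP; left; apply/eqP.
have Nr : (N%:R : R) ^+ r != 0 by rewrite expf_neq0.
by field.
Qed.

End quadratic_variation.

Lemma ae_quad_var_cvg (R : realType) (d : nat) (disp : measure_display)
    (T : measurableType disp) (P : probability T R)
    (Y : 'rV[R]_d -> {RV P >-> R}) (Omega : set 'rV[R]_d) (h : 'rV[R]_d)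
    (delta1 delta2 c1 c2 : R) (k p K : nat) :
  gaussian_field Y -> mean_zero Y -> 0 < delta1 -> delta1 < delta2 ->
  generalized_autocov k Y (fun t => c1 * enorm t `^ delta1 + c2 * enorm t `^ delta2) ->
  Omega !=set0 -> bounded_set Omega -> open Omega ->
  2 * (delta2 - delta1) < d%:R ->
  (k < p)%N -> delta2 <= K%:R -> (K + 2 * d <= 2 * p)%N ->
  {ae P, forall w, n%:R `^ (delta2 - delta1) *
    (quad_var Y Omega h delta1 p n w - mean_quad_var h delta1 delta2 c1 c2 p n)
    @[n --> \oo] --> (0 : R)}.
Proof.
move=> gY mY d0 d12 cY O0 bO oO gd kp dK Kp; set gamma := delta2 - delta1.
have [kappa hk] := @quad_var_moments R d disp T P Y Omega h delta1 delta2 c1 c2 k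
  gY mY d0 d12 cY bO p K kp dK Kp.
have [c c0 [n0 _ hN]] := card_lattice_points_ge O0 bO oO.
pose r := (Num.truncn (2 / (d%:R - 2 * gamma))).+1.
have gd0 : 0 < d%:R - 2 * gamma by rewrite subr_gt0.
have hr : 2 <= r%:R * (d%:R - 2 * gamma) by rewrite -ler_pdivrMr// ltW// truncnS_gt.
pose x n w : R := n%:R `^ gamma *
  (quad_var Y Omega h delta1 p n w - mean_quad_var h delta1 delta2 c1 c2 p n).
pose A : R := \prod_(i < r) (8 * (2 * i + 1)%:R ^+ 2) * (2 * kappa ^+ 2) ^+ r.
have A0 : 0 <= A.
  apply: mulr_ge0; last by rewrite exprn_ge0// mulr_ge0// sqr_ge0.
  by apply: prodr_ge0 => i _; rewrite mulr_ge0// sqr_ge0.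
pose B := A / c ^+ r.
have nR m : 0 < ((m + n0.+1)%N%:R : R) by rewrite ltr0n addnS.
have Nc m : c * (m + n0.+1)%:R ^+ d <= (set_size (lattice_points Omega (m + n0.+1)))%:R.
  by apply: hN; rewrite /= -addSnnS leq_addl.
have N0 m : (0 < set_size (lattice_points Omega (m + n0.+1)))%N.
  by rewrite -(ltr0n R) (lt_le_trans _ (Nc m))// mulr_gt0// exprn_gt0.
have n0' m : (0 < m + n0.+1)%N by rewrite addnS.
have ax m : all_moments P (x (m + n0.+1)%N).
  apply: all_momentsM; first exact: all_moments_cst.
  by have [] := hk _ (n0' m) (N0 m).
have bx m : \int[P]_w (x (m + n0.+1)%N w ^+ (2 * r)) <= B * (m.+1%:R ^+ 2)^-1.
  have [aq /(_ r) hq] := hk _ (n0' m) (N0 m).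
  have qs := Nc m; have Np := N0 m; move: aq hq qs Np; have := nR m.
  have mn : (m.+1 <= m + n0.+1)%N by rewrite addnS ltnS leq_addr.
  rewrite /x; move: (m + n0.+1)%N mn => n mn npos aq hq Ncn Np.
  under eq_Rintegral do rewrite exprMn.
  rewrite expectZ; last exact: all_momentsX.
  have gp : 0 <= (n%:R `^ gamma) ^+ (2 * r) :> R by rewrite exprn_ge0// powR_ge0.
  rewrite (le_trans (ler_wpM2l gp hq))// -/A.
  have cn0 : 0 < c * n%:R ^+ d by rewrite mulr_gt0// exprn_gt0.
  have h1 : ((set_size (lattice_points Omega n))%:R ^+ r)^-1 <= ((c * n%:R ^+ d) ^+ r)^-1.
    by rewrite lef_pV2 ?posrE ?exprn_gt0 ?ltr0n// lerXn2r// nnegrE// ltW.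
  rewrite (le_trans (ler_wpM2l gp (ler_wpM2l A0 h1)))//.
  have -> : (n%:R `^ gamma) ^+ (2 * r) * (A * ((c * n%:R ^+ d) ^+ r)^-1) =
      B * (n%:R `^ (gamma * (2 * r)%:R - (d * r)%:R)).
    have e1 : n%:R `^ (gamma * (2 * r)%:R) = (n%:R `^ gamma) ^+ (2 * r) :> R.
      by rewrite powRrM powR_mulrn ?powR_ge0.
    have e2 : n%:R `^ (- (d * r)%:R) = ((n%:R ^+ d) ^+ r)^-1 :> R.
      by rewrite (powR_invn _ (ltW npos)) exprM.
    rewrite [n%:R `^ (gamma * _ - _)]powRD ?(lt0r_neq0 npos) ?implybT// e1 e2 exprMn invfM /B.
    ring.
  rewrite ler_wpM2l//; first by rewrite divr_ge0// exprn_ge0// ltW.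
  apply: (@le_trans _ _ (n%:R `^ (- 2%:R))).
    by rewrite ler_powR ?ler1n ?(leq_trans _ mn)// !natrM; lra.
  rewrite (powR_invn _ (ltW npos)) lef_pV2 ?posrE ?exprn_gt0//.
  by apply: lerXn2r; rewrite ?nnegrE// ler_nat.
have ae0 : {ae P, forall w, x (m + n0.+1)%N w ^+ (2 * r) @[m --> \oo] --> (0 : R)}.
  apply: (@ae_cvg0_summable R disp T P (fun m w => x (m + n0.+1)%N w ^+ (2 * r))
    (fun m => B * (m.+1%:R ^+ 2)^-1) (B * 2)).
  - by move=> m; apply: measurable_funX; case: (ax m).
  - by move=> m w; rewrite exprM exprn_ge0// sqr_ge0.
  - move=> m; have iX := all_moments_integrable (all_momentsX (2 * r) (ax m)).
    rewrite -[leLHS]fineK; last exact: integrable_fin_num.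
    by rewrite lee_fin; exact: bx.
  - move=> N; rewrite -mulr_sumr ler_wpM2l// ?sum_inv_sqr_le//.
    by rewrite divr_ge0// exprn_ge0// ltW.
apply: filterS ae0 => w hw; rewrite -(cvg_shiftn n0.+1).
apply/cvgr0Pnorm_lt => e e0.
have er : 0 < e ^+ (2 * r) by rewrite exprn_gt0.
move/cvgr0Pnorm_lt : hw => /(_ _ er); apply: filterS => m.
by rewrite normrX ltr_pXn2r ?nnegrE// ltW.
Qed.

Lemma cvg_powRN (R : realType) (g : R) : 0 < g ->
  (n%:R `^ (- g)) @[n --> \oo] --> (0 : R).
Proof.
move=> g0; apply/cvgr0Pnorm_lt => e e0; near=> n.
have ne : (e^-1) `^ g^-1 < n%:R by near: n; exact: nbhs_infty_gtr.
have n0 : 0 < (n%:R : R) by rewrite (le_lt_trans _ ne)// powR_ge0.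
rewrite ger0_norm ?powR_ge0// powRN invf_plt ?posrE ?powR_gt0//.
have -> : e^-1 = ((e^-1) `^ g^-1) `^ g.
  by rewrite -powRrM mulVf ?gt_eqF// powRr1// invr_ge0 ltW.
by rewrite gt0_ltr_powR// ?nnegrE ?powR_ge0// ltW.
Unshelve. all: by end_near. Qed.

Lemma enorm_gt0 (R : realType) d (h : 'rV[R]_d) : h <> 0 -> 0 < enorm h.
Proof.
move=> h0; rewrite /enorm sqrtr_gt0 lt0r sumr_ge0 ?andbT => [|l _]; last exact: sqr_ge0.
apply/eqP => /eqP; rewrite psumr_eq0 => [/allP z|l _]; last exact: sqr_ge0.
apply: h0; apply/rowP => l; rewrite mxE; apply/eqP.
by have := z l (mem_index_enum l); rewrite sqrf_eq0.
Qed.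

Lemma c2_denomE (R : realType) d (h : 'rV[R]_d) (delta1 delta2 : R) p q : h <> 0 ->
  c2_denom h delta1 delta2 p q = enorm h `^ delta2 *
    (unit_Ccoef p delta2 -
     unit_Ccoef p delta1 / unit_Ccoef q delta1 * unit_Ccoef q delta2).
Proof.
move=> /enorm_gt0 h0; have a1 : enorm h `^ delta1 != 0 by rewrite gt_eqF// powR_gt0.
have CE r delta : Ccoef h r delta = enorm h `^ delta * unit_Ccoef r delta by [].
rewrite /c2_denom !CE -[in LHS]mulf_div divff// mul1r.
by rewrite mulrBr [_ * (_ / _ * _)]mulrCA.
Qed.

Theorem theorem4 (R : realType) (d : nat) (delta1 delta2 c1 c2 : R)
    (disp : measure_display) (T : measurableType disp) (P : probability T R)
    (Y : 'rV[R]_d -> {RV P >-> R}) (Omega : set 'rV[R]_d) (h : 'rV[R]_d)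
    (G := fun t : 'rV[R]_d =>
            c1 * enorm t `^ delta1 + c2 * enorm t `^ delta2)
    (k := Num.truncn (delta2 / 2)) :
  0 < delta1 -> delta1 < delta2 ->
  (forall m : int, delta1 <> 2 * m%:~R) ->
  (forall m : int, delta2 <> 2 * m%:~R) ->
  cond_posdef k G ->
  mean_zero Y -> gaussian_field Y -> generalized_autocov k Y G ->
  Omega !=set0 -> bounded_set Omega -> open Omega ->
  h <> 0 ->
  0 < 2 * (delta2 - delta1) -> 2 * (delta2 - delta1) < d%:R ->
  exists p q : nat,
    [/\ (0 < p)%N /\ (p < q)%N,
        [/\ Ccoef h p delta1 != 0, Ccoef h q delta1 != 0,
            c2_denom h delta1 delta2 p q != 0 &
            \forall n \near \oo, set_size (lattice_points Omega n) != 0%N],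
        {ae P, forall w, c1_hat Y Omega h delta1 p n w @[n --> \oo] --> c1} &
        {ae P, forall w,
          c2_hat Y Omega h delta1 delta2 p q n w @[n --> \oo] --> c2}].
Proof.
move=> d0 d12 dm1 dm2 _ mY gY cY O0 bO oO h0 _ gd.
pose K := (Num.truncn delta2).+1; pose p := (k.+1 + K + 2 * d)%N.
have dK : delta2 <= K%:R by rewrite ltW// truncnS_gt.
have p0 : (0 < p)%N by [].
have kp : (k < p)%N by rewrite /p -addnA leq_addr.
have Kp : (K + 2 * d <= 2 * p)%N by rewrite /p; lia.
have hn0 delta : enorm h `^ delta != 0 by rewrite gt_eqF// powR_gt0// enorm_gt0.
have Cp : Ccoef h p delta1 != 0 by rewrite mulf_neq0// unit_Ccoef_neq0.
have Cq : Ccoef h p.+1 delta1 != 0 by rewrite mulf_neq0// unit_Ccoef_neq0.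
have D0 : c2_denom h delta1 delta2 p p.+1 != 0.
  rewrite c2_denomE// mulf_neq0// unit_Ccoef_det_neq0//.
  by rewrite lt_eqF.
have aep := ae_quad_var_cvg h gY mY d0 d12 cY O0 bO oO gd kp dK Kp.
have aeq : {ae P, forall w, n%:R `^ (delta2 - delta1) *
    (quad_var Y Omega h delta1 p.+1 n w - mean_quad_var h delta1 delta2 c1 c2 p.+1 n)
    @[n --> \oo] --> (0 : R)}.
  by apply: (ae_quad_var_cvg h gY mY d0 d12 cY O0 bO oO gd _ dK); [rewrite ltnW|lia].
have g0 : 0 < delta2 - delta1 by rewrite subr_gt0.
exists p, p.+1; split=> //.
- split=> //; have [c c0] := card_lattice_points_ge O0 bO oO.
  move=> cN; near=> n.
  have n0 : 0 < (n%:R : R) by rewrite ltr0n; near: n; exact: nbhs_infty_gt.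
  rewrite -lt0n -(ltr0n R); apply: (@lt_le_trans _ _ (c * n%:R ^+ d)).
    by rewrite mulr_gt0// exprn_gt0.
  by near: n.
- apply: filterS aep => w hw.
  have cN := cvg_powRN g0.
  have : n%:R `^ (- (delta2 - delta1)) * (n%:R `^ (delta2 - delta1) *
      (quad_var Y Omega h delta1 p n w - mean_quad_var h delta1 delta2 c1 c2 p n)) / Ccoef h p delta1
      + (c1 + c2 * n%:R `^ (- (delta2 - delta1)) * (Ccoef h p delta2 / Ccoef h p delta1))
      @[n --> \oo] --> 0 * 0 / Ccoef h p delta1 + (c1 + c2 * 0 * (Ccoef h p delta2 / Ccoef h p delta1)).
    apply: cvgD; first by apply: cvgM; [exact: cvgM|exact: cvg_cst].
    apply: cvgD; first exact: cvg_cst.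
    by apply: cvgM; [apply: cvgM => //; exact: cvg_cst|exact: cvg_cst].
  rewrite mulr0 !mul0r add0r mulr0 mul0r addr0.
  apply: cvg_trans; apply: near_eq_cvg; near=> n.
  have n0 : (0 < n)%N by near: n; exact: nbhs_infty_gt.
  have gn : n%:R `^ (delta2 - delta1) != 0 :> R by rewrite gt_eqF// powR_gt0// ltr0n.
  by rewrite /c1_hat /mean_quad_var powRN mulKf//; field; rewrite Cp gn.
- apply: filterS2 aep aeq => w hp hq; rewrite /c2_hat.
  set rho := Ccoef h p delta1 / Ccoef h p.+1 delta1.
  set D := c2_denom h delta1 delta2 p p.+1 in D0 *.
  have : ((n%:R `^ (delta2 - delta1) *
      (quad_var Y Omega h delta1 p n w - mean_quad_var h delta1 delta2 c1 c2 p n) -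
      rho * (n%:R `^ (delta2 - delta1) *
      (quad_var Y Omega h delta1 p.+1 n w - mean_quad_var h delta1 delta2 c1 c2 p.+1 n))) / D + c2)
      @[n --> \oo] --> (0 - rho * 0) / D + c2.
    apply: cvgD; last exact: cvg_cst.
    apply: cvgM; last exact: cvg_cst.
    by apply: cvgB => //; apply: cvgM => //; exact: cvg_cst.
  rewrite mulr0 subrr mul0r add0r.
  apply: cvg_trans; apply: near_eq_cvg; near=> n.
  have n0 : (0 < n)%N by near: n; exact: nbhs_infty_gt.
  have gn : n%:R `^ (delta2 - delta1) != 0 :> R by rewrite gt_eqF// powR_gt0// ltr0n.
  have DE : D = Ccoef h p delta2 - rho * Ccoef h p.+1 delta2 by [].
  have rE : Ccoef h p delta1 = rho * Ccoef h p.+1 delta1 by rewrite /rho divfK.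
  rewrite /mean_quad_var powRN.
  apply: (mulIf D0); rewrite mulrDl -[RHS]mulrA !divfK// DE.
  rewrite [Ccoef h p delta1]rE; move: (rho) (Ccoef h p.+1 delta1) (Ccoef h p delta2) => r C1 C2.
  by field.
Unshelve. all: by end_near. Qed.
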